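(* Let $\lambda_1,\lambda_2,\mu_1,\mu_2>0$, $\eta_1>0$, $p\in[0,1]$, and let $\eta_2=0$. For all $t\ge 0$ and $j,n\in\mathbb{N}_0$, the transition probabilities $p_{n,i}(t)=\mathbb{P}[{\bf N}(t)=(n,i)]$ of ${\bf N}(t)$, with initial state $(j,1)$ with probability $p$ and $(j,2)$ with probability $1-p$, can be expressed as $$p_{n,1}(t)=p\,e^{-\eta_1t}\,\widehat p^{(1)}_{j,n}(t),$$ $$p_{n,2}(t)=(1-p)\,\widehat p^{(2)}_{j,n}(t)+p\,\eta_1\sum_{k=0}^{+\infty}\int_0^te^{-\eta_1\tau}\,\widehat p^{(1)}_{j,k}(\tau)\,\widehat p^{(2)}_{k,n}(t-\tau)\,d\tau,$$ where, for $i=1,2$, $j,n\in\mathbb{N}_0$ and $t\ge 0$, $$\widehat p^{(i)}_{j,n}(t)=e^{-(\lambda_i+\mu_i)t}\Big\{\Big(\frac{\lambda_i}{\mu_i}\Big)^{\frac{n-j}{2}}I_{n-j}(2t\sqrt{\lambda_i\mu_i})+\Big(\frac{\lambda_i}{\mu_i}\Big)^{\frac{n-j-1}{2}}I_{n+j+1}(2t\sqrt{\lambda_i\mu_i})+\Big(1-\frac{\lambda_i}{\mu_i}\Big)\Big(\frac{\lambda_i}{\mu_i}\Big)^{n}\sum_{k=n+j+2}^{\infty}\Big(\frac{\mu_i}{\lambda_i}\Big)^{\frac k2}I_k(2t\sqrt{\lambda_i\mu_i})\Big\}.$$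
   Context: $\mathbb N_0=\{0,1,2,\dots\}$. $\{{\bf N}(t)=[N(t),\mathscr{E}(t)],\,t\ge 0\}$ is the continuous-time Markov chain on $\mathbb{N}_0\times\{1,2\}$ (an $M/M/1$ queue in two environments, where with $\eta_2=0$ only switches from environment 1 to environment 2 are allowed) with transition rates: for $i=1,2$, $(n,i)\to(n+1,i)$ at rate $\lambda_i$ ($n\ge 0$), $(n,i)\to(n-1,i)$ at rate $\mu_i$ ($n\ge 1$), and $(n,1)\to(n,2)$ at rate $\eta_1$ ($n\ge 0$). $I_\nu$ is the modified Bessel function of the first kind. The function $\widehat p^{(i)}_{j,n}(t)$ is the transition probability from $j$ to $n$ in time $t$ of the ordinary $M/M/1$ queue length process with arrival rate $\lambda_i$ and service rate $\mu_i$. *)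

(* Defs.v *)
From HB Require Import structures.
From mathcomp Require Import all_boot all_order all_algebra.
From mathcomp Require Import all_classical all_reals all_analysis.

Set Implicit Arguments.
Unset Strict Implicit.
Unset Printing Implicit Defensive.

Import Order.TTheory GRing.Theory Num.Theory.
Import numFieldNormedType.Exports.

Local Open Scope classical_set_scope.
Local Open Scope ring_scope.

(* Continuous-time Markov chains on a countable state space. Time is a real
   number; every condition only concerns nonnegative times. *)

Definition transition_function (R : realType) (S : countType)
    (f : R -> S -> S -> R) : Prop :=
  [/\ forall (t : R) (x y : S), 0 <= t -> 0 <= f t x y,
      forall (t : R) (x : S), 0 <= t -> \esum_(y in [set: S]) (f t x y)%:E = 1%:E,
      forall x y, f 0 x y = (x == y)%:R
    & forall (s t : R) (x y : S), 0 <= s -> 0 <= t ->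
        (f (s + t) x y)%:E = \esum_(z in [set: S]) (f s x z * f t z y)%:E].

(* [q x y] is the rate of the jump from [x] to [y] for [x != y]; the diagonal
   values of [q] are irrelevant. The second condition says that the total rate
   of leaving [x] is the sum of the rates of the jumps out of [x]
   (conservativity). *)
Definition has_rates (R : realType) (S : countType) (q : S -> S -> R)
    (f : R -> S -> S -> R) : Prop :=
  (forall x y, x != y -> f h x y / h @[h --> 0^'+] --> q x y) /\
  (forall x, ((1 - f h x x) / h)%:E @[h --> 0^'+] -->
     \esum_(y in [set~ x]) (q x y)%:E).

(* The time-homogeneous Markov property: [H] is a finite list of pairs
   (time, state) prescribing the past before time [s]. *)
Definition markov_process (R : realType) (d : measure_display)
    (Omega : measurableType d) (P : probability Omega R) (S : countType)
    (f : R -> S -> S -> R) (X : R -> Omega -> S) : Prop :=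
  (forall (t : R) (x : S), 0 <= t -> measurable [set w | X t w = x]) /\
  (forall (H : seq (R * S)) (s t : R) (x y : S),
    (forall u : R * S, u \in H -> 0 <= u.1 <= s) -> 0 <= s -> 0 <= t ->
    let past : set Omega := [set w | forall u : R * S, u \in H -> X u.1 w = u.2] in
    P (past `&` [set w | X s w = x] `&` [set w | X (s + t) w = y]) =
    (P (past `&` [set w | X s w = x])%classic * (f t x y)%:E)%E).

Definition ctmc (R : realType) (d : measure_display)
    (Omega : measurableType d) (P : probability Omega R) (S : countType)
    (q : S -> S -> R) (X : R -> Omega -> S) : Prop :=
  exists f : R -> S -> S -> R,
    [/\ transition_function f, has_rates q f & markov_process P f X].

Definition mm1_rate (R : realType) (la mu : R) (m n : nat) : R :=
  if n == m.+1 then la else if m == n.+1 then mu else 0.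

(* The two environments 1 and 2 are encoded by the two booleans. *)
Notation env := bool.
Notation env1 := false.
Notation env2 := true.

Definition queue_rate (R : realType) (lambda mu eta : env -> R)
    (x y : nat * env) : R :=
  if x.2 == y.2 then mm1_rate (lambda x.2) (mu x.2) x.1 y.1
  else if x.1 == y.1 then eta x.2 else 0.

(* The series sum_k (x/2)^(2k+nu) / (k! Gamma(k+nu+1)) for an integer order
   [nu], where 1/Gamma vanishes at the nonpositive integers. *)
Definition besselI (R : realType) (nu : int) (x : R) : R :=
  \big[+%R/0]_(0 <= k <oo)
    match k%:Z + nu with
    | Posz m => (x / 2) ^+ (k + m) / (k`!%:R * m`!%:R)
    | Negz _ => 0
    end.

Definition phat (R : realType) (la mu : R) (t : R) (j n : nat) : R :=
  let z := 2 * t * Num.sqrt (la * mu) in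
  expR (- (la + mu) * t) *
  ((la / mu) `^ ((n%:R - j%:R) / 2) * besselI (n%:Z - j%:Z) z
   + (la / mu) `^ ((n%:R - j%:R - 1) / 2) * besselI (n + j + 1)%:Z z
   + (1 - la / mu) * (la / mu) ^+ n *
     \big[+%R/0]_(n + j + 2 <= k <oo) ((mu / la) `^ (k%:R / 2) * besselI k%:Z z)).

(* Main.v *)
Require Import Defs.
From HB Require Import structures.
From mathcomp Require Import all_boot all_order all_algebra.
From mathcomp Require Import all_classical all_reals all_analysis.
From mathcomp Require Import measurable_realfun.
From mathcomp Require Import ring lra zify.

Set Implicit Arguments.
Unset Strict Implicit.
Unset Printing Implicit Defensive.

Import Order.TTheory GRing.Theory Num.Theory.
Import numFieldNormedType.Exports.

Local Open Scope classical_set_scope.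
Local Open Scope ring_scope.

(** Uniformization. A conservative rate matrix [Q] with exit rates at most [c]
    is [A - c I] for a nonnegative matrix [A] whose rows sum to [c], and the chain
    has transition probabilities
    [e^(-ct) sum_m (t^m / m!) A^m(x, y)] ([uniformized]).
    Its total mass and the Chapman-Kolmogorov equation follow from [A^m] having
    row sums [c^m] and from [A^(k+l) = A^k A^l] by rearranging nonnegative
    series ([uniformized_transition]), and its derivative at [0] is [Q]
    ([uniformized_generated]).

    The rates determine the transition function ([generated_unique]).
    Let [f] have rates [Q]. By Chapman-Kolmogorov the lower right derivative of
    [e^(ct) f_t(x, y)] is at least [sum_z A(x, z) e^(ct) f_t(z, y)]; starting
    from [0 <= e^(ct) f_t] and integrating repeatedly, [e^(ct) f_t] dominates
    all partial sums of the series. So [f] dominates the uniformized semigroup,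
    and both have total mass [1].

    For the queue, [A] moves up with weight [lambda] and down with weight [mu],
    a step down from [0] being wasted. Its powers follow from those of the free
    walk on the integers by a reflection argument ([walk_reflection]), and the
    exponential generating functions of the free walk are the Bessel functions
    ([bessel_free_walk]); this gives the closed formula ([phat_uniformized]).

    With [eta_2 = 0] the matrix [A] of the two-environment queue is block
    triangular. Its diagonal blocks are queues with self-loops, which changes
    the uniformization rate but not the rates of jump ([phat_lazy]), up to the
    killing factor [e^(- eta_1 t)]. Its off-diagonal block sums over the time of
    the switch ([walk_env12]), and the Beta integral
    [int_0^t x^i (t - x)^l dx = i! l! t^(i+l+1) / (i+l+1)!]
    turns that sum into the convolution of the statement ([queue_env12]). *)

(** * Series of nonnegative terms *)

Section Series.
Variable R : realType.

(** Finiteness of the sum in the extended reals carries convergence back to the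
    real series, whose limit would otherwise be a default value. *)
Lemma cvg_nneseries_fin (a : nat -> R) (N : nat) (r : R) :
  (forall m, (N <= m)%N -> 0 <= a m) ->
  (\sum_(N <= m <oo) (a m)%:E)%E = r%:E ->
  (fun n => \sum_(N <= m < n) a m) @ \oo --> r.
Proof.
move=> a0 ar.
have cv : cvgn (fun n => (\sum_(N <= m < n) (a m)%:E)%E).
  by apply: is_cvg_nneseries => n Nn _; rewrite lee_fin a0.
rewrite ar in cv; move/fine_cvg: cv => cv.
apply: cvg_trans cv; apply: near_eq_cvg.
by apply: nearW => n /=; rewrite sumEFin.
Qed.

Lemma lim_nneseries_fin (a : nat -> R) (N : nat) (r : R) :
  (forall m, (N <= m)%N -> 0 <= a m) ->
  (\sum_(N <= m <oo) (a m)%:E)%E = r%:E ->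
  \big[+%R/0]_(N <= m <oo) a m = r.
Proof. by move=> a0 ar; apply/cvg_lim => //; exact: cvg_nneseries_fin. Qed.

Lemma eq_lim_series (a b : nat -> R) (N : nat) : (forall m, a m = b m) ->
  \big[+%R/0]_(N <= m <oo) a m = \big[+%R/0]_(N <= m <oo) b m.
Proof. by move=> /funext ->. Qed.

Lemma esumZl (T : choiceType) (A : set T) (r : R) (a : T -> \bar R) :
  0 <= r -> (forall x, (0 <= a x)%E) ->
  (\esum_(x in A) (r%:E * a x) = r%:E * \esum_(x in A) a x)%E.
Proof.
move=> r0 a0; rewrite /esum -ereal_supZl//; last first.
  apply/set0P; exists 0%E; exists set0; first exact: fsets_set0.
  by rewrite fsbig_set0.
congr ereal_sup; apply/seteqP; split=> x /=.
  move=> [F FA <-]; exists (\sum_(x \in F) a x)%E; first by exists F.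
  by rewrite ge0_mule_fsumr.
by move=> [y [F FA <-] <-]; exists F => //; rewrite ge0_mule_fsumr.
Qed.

Lemma esum_nneseries (T : choiceType) (a : T -> nat -> \bar R) :
  (forall x m, (0 <= a x m)%E) ->
  (\esum_(x in [set: T]) \sum_(m <oo) a x m =
   \sum_(m <oo) \esum_(x in [set: T]) a x m)%E.
Proof.
move=> a0; rewrite nneseries_esumT; last by move=> n; apply: esum_ge0.
under eq_esum do rewrite nneseries_esumT//.
rewrite !esum_esum//.
rewrite (reindex_esum ([set: nat] `*`` fun=> [set: T]) _ (fun x => (x.2, x.1)))//.
split=> //=; first by move=> [i1 i2] [j1 j2] /= _ _ [] -> ->.
by move=> [i1 i2] _ /=; exists (i2, i1).
Qed.

(** Cauchy product: the left-hand side runs through the quadrant along its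
    antidiagonals, and nonnegativity permits the rearrangement. *)
Lemma nneseries_antidiagonal (a : nat -> nat -> \bar R) :
  (forall k l, (0 <= a k l)%E) ->
  (\sum_(m <oo) \sum_(k < m.+1) a k (m - k)%N =
   \sum_(k <oo) \sum_(l <oo) a k l)%E.
Proof.
move=> a0; pose b m k := if (k <= m)%N then a k (m - k)%N else 0%E.
have b0 m k : (0 <= b m k)%E by rewrite /b; case: ifP.
transitivity (\sum_(m <oo) \sum_(k <oo) b m k)%E.
  apply: eq_eseriesr => m _.
  rewrite (nneseries_split 0 m.+1)// [X in (_ + X)%E]eseries0 ?adde0; last first.
    by rewrite add0n => k mk _; rewrite /b leqNgt mk.
  rewrite add0n big_mkord; apply: eq_bigr => -[k km] _ /=.
  by rewrite /b -ltnS km.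
rewrite nneseries_interchange//; apply: eq_eseriesr => k _.
rewrite (nneseries_split 0 k)// add0n big1_seq ?add0e; last first.
  by move=> i /=; rewrite mem_index_iota /b => /andP[_ ik]; rewrite leqNgt ik.
rewrite -nneseries_addn//; apply: eq_eseriesr => l _.
by rewrite /b leq_addl addnK.
Qed.

Lemma nneseries_mul (a b : nat -> R) :
  (forall k, 0 <= a k) -> (forall l, 0 <= b l) ->
  (\sum_(k <oo) (a k)%:E)%E \is a fin_num ->
  (\sum_(l <oo) (b l)%:E)%E \is a fin_num ->
  ((\sum_(k <oo) (a k)%:E) * (\sum_(l <oo) (b l)%:E) =
   \sum_(k <oo) \sum_(l <oo) (a k * b l)%:E)%E.
Proof.
move=> a0 b0 afin bfin; rewrite -(fineK bfin) muleC -nneseriesZl; last first.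
  by move=> k _; rewrite lee_fin.
apply: eq_eseriesr => k _; rewrite fineK// muleC -nneseriesZl; last first.
  by move=> l _; rewrite lee_fin.
by apply: eq_eseriesr => l _; rewrite EFinM.
Qed.

Lemma nneseries_expR (x : R) : 0 <= x ->
  (\sum_(m <oo) (x ^+ m / m`!%:R)%:E = (expR x)%:E)%E.
Proof.
move=> x0; rewrite /expR -EFin_lim; last exact: is_cvg_series_exp_coeff.
by apply: congr_lim; apply/funext => n /=; rewrite sumEFin.
Qed.

End Series.

(** * Uniformization *)

Section Walk.
Variables (R : realType) (S : countType) (moves : S -> seq (R * S)).

(** The nonnegative matrix [A] is given by its rows, each a finite list of pairs
    (weight, target), so that its powers are finite sums; [step] is its action
    on functions, and [walk m] is the matrix [A ^ m]. *)
Definition step (g : S -> R) (x : S) : R :=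
  \sum_(a <- moves x) a.1 * g a.2.

Definition walk (m : nat) (x y : S) : R :=
  iter m step (fun z => (z == y)%:R) x.

Arguments walk : simpl never.

(** The exponential of [t (A - c I)]. *)
Definition uniformized (c t : R) (x y : S) : R :=
  expR (- c * t) * \big[+%R/0]_(0 <= m <oo) (t ^+ m / m`!%:R * walk m x y).

Lemma walk0 x y : walk 0 x y = (x == y)%:R. Proof. by []. Qed.

Lemma walkS m x y :
  walk m.+1 x y = \sum_(a <- moves x) a.1 * walk m a.2 y.
Proof. by []. Qed.

Lemma walk1 x y : walk 1 x y = \sum_(a <- moves x) a.1 * (a.2 == y)%:R.
Proof. by []. Qed.

Variable c : R.
Hypothesis moves_ge0 : forall x a, a \in moves x -> 0 <= a.1.
Hypothesis moves_sum : forall x, \sum_(a <- moves x) a.1 = c.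

Let c_ge0 (x : S) : 0 <= c.
Proof. by rewrite -(moves_sum x) big_seq sumr_ge0// => a; exact: moves_ge0. Qed.

Lemma iter_step_ge0 m g x : (forall z, 0 <= g z) -> 0 <= iter m step g x.
Proof.
move=> g0; elim: m x => [|m IH] x //=.
rewrite /step big_seq sumr_ge0// => a ax.
by rewrite mulr_ge0// (moves_ge0 ax).
Qed.

Lemma walk_ge0 m x y : 0 <= walk m x y.
Proof. by apply: iter_step_ge0 => z; rewrite ler0n. Qed.

Lemma esum_delta (x : S) (g : S -> R) : 0 <= g x ->
  (\esum_(z in [set: S]) ((x == z)%:R * g z)%:E)%E = (g x)%:E.
Proof.
move=> g0; rewrite -(@esum_set1 R S x (fun z => (g z)%:E)) ?lee_fin//.
rewrite [RHS]esum_mkcond; apply: eq_esum => z _.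
case: ifPn => [/[!inE]/= ->|]; first by rewrite eqxx mul1r.
rewrite notin_setE/= => xz; case: eqP => [zx|_]; last by rewrite mul0r.
by rewrite zx in xz.
Qed.

(** The Chapman-Kolmogorov equation of the walk ([walkD]) is the case where [g]
    is a column of a power of [A], and the row sums ([walk_total]) the case
    [g = 1]. *)
Lemma esum_walk m g x : (forall z, 0 <= g z) ->
  (\esum_(z in [set: S]) (walk m x z * g z)%:E)%E = (iter m step g x)%:E.
Proof.
move=> g0; elim: m x => [|m IH] x; first exact: esum_delta.
rewrite iterS {2}/step -sumEFin.
transitivity (\esum_(z in [set: S]) \sum_(a <- moves x | a \in moves x)
  (a.1 * (walk m a.2 z * g z))%:E)%E.
  apply: eq_esum => z _; rewrite -big_seq walkS mulr_suml sumEFin.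
  by congr EFin; apply: eq_bigr => a _; rewrite mulrA.
rewrite esum_sum; last first.
  by move=> z a _ ax; rewrite lee_fin !mulr_ge0 ?walk_ge0 ?(moves_ge0 ax).
rewrite [RHS]big_seq; apply: eq_bigr => a ax.
rewrite EFinM -IH -esumZl ?(moves_ge0 ax)//.
by move=> z; rewrite lee_fin mulr_ge0 ?walk_ge0.
Qed.

Lemma walkD k l x y :
  (\esum_(z in [set: S]) (walk k x z * walk l z y)%:E)%E = (walk (k + l) x y)%:E.
Proof.
rewrite esum_walk; last by move=> z; exact: walk_ge0.
by rewrite /walk iterD.
Qed.

Lemma walk_total m x :
  (\esum_(y in [set: S]) (walk m x y)%:E)%E = (c ^+ m)%:E.
Proof.
transitivity (\esum_(y in [set: S]) (walk m x y * 1)%:E)%E.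
  by apply: eq_esum => y _; rewrite mulr1.
rewrite (@esum_walk m (fun=> 1)) //; congr EFin.
elim: m x => [|m IH] x; first by rewrite expr0.
rewrite iterS {1}/step exprS -{1}(moves_sum x) mulr_suml.
by apply: eq_bigr => a _; rewrite IH.
Qed.

Lemma walk_le m x y : walk m x y <= c ^+ m.
Proof.
rewrite -lee_fin -(walk_total m x); apply: esum_ge; exists [set y].
  by split => //; exact: finite_set1.
by rewrite fsbig_set1.
Qed.

Lemma walk_term_ge0 t m x y : 0 <= t -> 0 <= t ^+ m / m`!%:R * walk m x y.
Proof.
by move=> t0; rewrite mulr_ge0 ?walk_ge0// mulr_ge0 ?exprn_ge0 ?invr_ge0 ?ler0n.
Qed.

Lemma walk_series_fin t x y : 0 <= t ->
  (\sum_(m <oo) (t ^+ m / m`!%:R * walk m x y)%:E)%E \is a fin_num.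
Proof.
move=> t0; rewrite ge0_fin_numE; last first.
  by apply: nneseries_ge0 => m _ _; rewrite lee_fin walk_term_ge0.
apply: (@le_lt_trans _ _ (expR (c * t))%:E); last by rewrite ltry.
rewrite -nneseries_expR ?mulr_ge0 ?(c_ge0 x)//.
apply: lee_nneseries => [m _ _|m _]; rewrite lee_fin ?walk_term_ge0//.
rewrite exprMn mulrC mulrA ler_wpM2r ?invr_ge0 ?ler0n//.
by rewrite ler_wpM2r ?exprn_ge0 ?walk_le.
Qed.

Lemma uniformizedE t x y : 0 <= t ->
  ((uniformized c t x y)%:E =
   (expR (- c * t))%:E * \sum_(m <oo) (t ^+ m / m`!%:R * walk m x y)%:E)%E.
Proof.
move=> t0; rewrite /uniformized EFinM; congr (_ * _)%E.
rewrite -(fineK (walk_series_fin x y t0)); congr EFin.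
apply: lim_nneseries_fin => [m _|]; first exact: walk_term_ge0.
by rewrite fineK// walk_series_fin.
Qed.

Lemma uniformized_ge0 t x y : 0 <= t -> 0 <= uniformized c t x y.
Proof.
move=> t0; rewrite -lee_fin uniformizedE// mule_ge0 ?lee_fin ?expR_ge0//.
by apply: nneseries_ge0 => m _ _; rewrite lee_fin walk_term_ge0.
Qed.

Lemma walk_series_ge0 t x y : 0 <= t ->
  (0 <= \sum_(m <oo) (t ^+ m / m`!%:R * walk m x y)%:E)%E.
Proof.
by move=> t0; apply: nneseries_ge0 => m _ _; rewrite lee_fin walk_term_ge0.
Qed.

Lemma uniformized_total t x : 0 <= t ->
  (\esum_(y in [set: S]) (uniformized c t x y)%:E)%E = 1%:E.
Proof.
move=> t0; under eq_esum do rewrite uniformizedE//.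
rewrite esumZl ?expR_ge0//; last by move=> y; exact: walk_series_ge0.
rewrite esum_nneseries; last by move=> y m; rewrite lee_fin walk_term_ge0.
transitivity ((expR (- c * t))%:E *
    \sum_(m <oo) ((c * t) ^+ m / m`!%:R)%:E)%E.
  congr (_ * _)%E; apply: eq_eseriesr => m _.
  under eq_esum do rewrite EFinM.
  rewrite esumZl ?walk_total; last first.
  - by move=> y; rewrite lee_fin walk_ge0.
  - by rewrite mulr_ge0 ?exprn_ge0 ?invr_ge0 ?ler0n.
  by rewrite -EFinM exprMn; congr EFin; rewrite mulrC mulrA.
rewrite nneseries_expR ?mulr_ge0 ?(c_ge0 x)//.
by rewrite -EFinM -expRD mulNr addNr expR0.
Qed.

Lemma uniformized0 x y : uniformized c 0 x y = (x == y)%:R.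
Proof.
apply: EFin_inj; rewrite uniformizedE// mulr0 expR0 mul1e.
rewrite nneseries_recl//; last by move=> m; rewrite lee_fin walk_term_ge0.
rewrite expr0 fact0 divr1 mul1r eseries0; first by rewrite adde0.
by case=> // m _ _; rewrite expr0n !mul0r.
Qed.

(** By the binomial formula [(s + t)^m / m!] splits along [k + l = m], and
    [A^(k + l) = A^k A^l]; all the series have nonnegative terms. *)
Lemma uniformizedD s t x y : 0 <= s -> 0 <= t ->
  ((uniformized c (s + t) x y)%:E =
   \esum_(z in [set: S]) (uniformized c s x z * uniformized c t z y)%:E)%E.
Proof.
move=> s0 t0.
have es m u v : 0 <= s ^+ m / m`!%:R * walk m u v by exact: walk_term_ge0.
have et m u v : 0 <= t ^+ m / m`!%:R * walk m u v by exact: walk_term_ge0.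
transitivity ((expR (- c * (s + t)))%:E *
  \sum_(k <oo) \sum_(l <oo)
    (s ^+ k / k`!%:R * (t ^+ l / l`!%:R) * walk (k + l) x y)%:E)%E.
  rewrite uniformizedE ?addr_ge0//; congr (_ * _)%E.
  rewrite -nneseries_antidiagonal; last first.
    by move=> k l; rewrite lee_fin mulr_ge0 ?walk_ge0// !mulr_ge0 ?exprn_ge0
      ?invr_ge0 ?ler0n.
  apply: eq_eseriesr => m _; rewrite sumEFin; congr EFin.
  rewrite addrC exprDn mulr_suml mulr_suml; apply: eq_bigr => -[k km] _ /=.
  rewrite ltnS in km; rewrite subnKC//; congr (_ * _).
  have f0 n : n`!%:R != 0 :> R by rewrite pnatr_eq0 -lt0n fact_gt0.
  rewrite -(bin_fact km) !natrM -mulr_natr.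
  have b0 : 'C(m, k)%:R != 0 :> R by rewrite pnatr_eq0 -lt0n bin_gt0.
  by field; rewrite !f0 b0.
transitivity (\esum_(z in [set: S]) ((expR (- c * (s + t)))%:E *
    \sum_(k <oo) \sum_(l <oo) ((s ^+ k / k`!%:R * walk k x z) *
      (t ^+ l / l`!%:R * walk l z y))%:E))%E; last first.
  apply: eq_esum => z _; rewrite EFinM !uniformizedE//.
  rewrite mulrDr expRD EFinM muleACA; congr (_ * _)%E.
  by rewrite nneseries_mul ?walk_series_fin.
rewrite esumZl ?expR_ge0//; last first.
  by move=> z; do 2!(apply: nneseries_ge0 => ? _ _); rewrite lee_fin mulr_ge0.
congr (_ * _)%E; rewrite esum_nneseries; last first.
  by move=> z k; apply: nneseries_ge0 => ? _ _; rewrite lee_fin mulr_ge0.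
apply: eq_eseriesr => k _; rewrite esum_nneseries; last first.
  by move=> z l; rewrite lee_fin mulr_ge0.
apply: eq_eseriesr => l _; rewrite EFinM -walkD -esumZl; last first.
- by move=> z; rewrite lee_fin mulr_ge0 ?walk_ge0.
- by rewrite !mulr_ge0 ?exprn_ge0 ?invr_ge0 ?ler0n.
by apply: eq_esum => z _; rewrite -EFinM; congr EFin; ring.
Qed.

Lemma uniformized_transition : transition_function (uniformized c).
Proof.
split; [exact: uniformized_ge0|exact: uniformized_total|exact: uniformized0|].
exact: uniformizedD.
Qed.

End Walk.

Arguments walk : simpl never.

(** * Right derivatives and a Dini criterion *)

Section RightDerivative.
Variable R : realType.

Lemma is_derive_right (g : R -> R) (t d : R) : is_derive t 1 g d ->
  (g (t + h) - g t) / h @[h --> 0^'+] --> d.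
Proof.
move=> [dg gd]; apply: cvg_dnbhs_at_right; move: dg.
rewrite /derivable => dg; have : h^-1 *: (g (h *: 1 + t) - g t) @[h --> 0^'] --> d.
  by rewrite -gd.
apply: cvg_trans; apply: near_eq_cvg; apply: nearW => h /=.
by rewrite /GRing.scale/= mulr1 mulrC [h + t]addrC.
Qed.

Lemma expRM_right (a : R) : (expR (a * h) - 1) / h @[h --> 0^'+] --> a.
Proof.
have /is_derive_right : is_derive (0 : R) 1 (fun h : R => expR (a * h)) a.
  by apply: is_derive_eq; rewrite mulr0 expR0 mul1r /GRing.scale/= mulr1.
by apply: cvg_trans; apply: near_eq_cvg; apply: nearW => h; rewrite add0r mulr0 expR0.
Qed.

Lemma cvg_right_eq (f g : R -> R) (l : R) : (forall h, 0 < h -> f h = g h) ->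
  f h @[h --> 0^'+] --> l -> g h @[h --> 0^'+] --> l.
Proof.
move=> fg; apply: cvg_trans; apply: near_eq_cvg; near=> h.
by apply: fg; near: h; exact: nbhs_right_gt.
Unshelve. all: by end_near. Qed.

Lemma cvg_right_quotient (g : R -> R) (l d : R) :
  (g h - l) / h @[h --> 0^'+] --> d -> g h @[h --> 0^'+] --> l.
Proof.
move=> gd; have h0 : h @[h --> (0 : R)^'+] --> (0 : R).
  by apply: cvg_at_right_filter; exact: cvg_id.
have : l + h * ((g h - l) / h) @[h --> 0^'+] --> l + 0 * d.
  by apply: cvgD; [exact: cvg_cst|exact: cvgM].
rewrite mul0r addr0; apply: cvg_right_eq => h hp.
by rewrite mulrC divfK ?gt_eqF// addrC subrK.
Qed.

Lemma expRM_right1 (a : R) : expR (a * h) @[h --> 0^'+] --> (1 : R).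
Proof.
exact: (@cvg_right_quotient (fun h => expR (a * h)) 1 a (@expRM_right a)).
Qed.

Lemma near0_rightP (P : R -> Prop) : (\forall h \near 0^'+, P h) ->
  exists2 d, 0 < d & forall h, 0 < h < d -> P h.
Proof.
move=> [d /= d0 dP]; exists d => // h /andP[h0 hd]; apply: dP => //=.
by rewrite sub0r normrN gtr0_norm.
Qed.

(** If [u] became negative, it would have to leave the nonnegative values at
    the supremum of the times where it lies above a line of small negative
    slope; left semicontinuity puts that supremum among those times, and the
    lower right derivative lets one continue beyond it. *)
Lemma dini_ge0 (u : R -> R) : 0 <= u 0 ->
  (forall s e, 0 < s -> 0 < e -> \forall h \near 0^'+, u (s - h) <= u s + e) ->
  (forall s e, 0 <= s -> 0 < e -> \forall h \near 0^'+, u s - e * h <= u (s + h)) ->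
  forall t, 0 <= t -> 0 <= u t.
Proof.
move=> u0 ul ur T T0; rewrite leNgt; apply/negP => uT.
have {T0}T0 : 0 < T.
  by rewrite lt_neqAle T0 andbT; apply/eqP => T00; move: uT; rewrite -T00 ltNge u0.
(* The slope [e] is such that [v] is still negative at [T]. *)
pose e := - u T / (2 * T); have e0 : 0 < e by rewrite divr_gt0 ?mulr_gt0 ?oppr_gt0.
pose v r := u r + e * r.
have vT : v T < 0.
  have -> : v T = u T / 2 by rewrite /v /e; field; rewrite gt_eqF.
  by rewrite pmulr_llt0 ?invr_gt0.
pose A := [set r | 0 <= r <= T /\ 0 <= v r].
have A0 : A 0 by rewrite /A /= lexx ltW// /v mulr0 addr0.
have supA : has_sup A by split; [exists 0|exists T => r [/andP[]]].
pose s := sup A.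
have s0 : 0 <= s by apply: ub_le_sup => //; case: supA.
have sT : s <= T by apply: sup_le_ub; [exists 0|move=> r [/andP[]]].
have vs : 0 <= v s.
  rewrite leNgt; apply/negP => vs.
  have {}s0 : 0 < s.
    rewrite lt_neqAle s0 andbT; apply/eqP => s00; move: vs.
    by rewrite -s00 /v mulr0 addr0 ltNge u0.
  have := ul s (- v s / 2) s0; rewrite divr_gt0 ?oppr_gt0// => /(_ isT).
  move=> /near0_rightP[d d0 dP].
  have [r Ar rs] := @sup_adherent _ A d d0 supA.
  have {}rs : s - d < r := rs.
  have rs' : r <= s by apply: ub_le_sup => //; case: supA.
  move: (Ar) => [/andP[r0 _]]; rewrite leNgt => /negP; apply.
  have [->//|rNs] := eqVneq r s; have {}rs' : r < s by rewrite lt_neqAle rNs.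
  have := dP (s - r); rewrite subr_gt0 rs' /= ltrBlDr -ltrBlDl rs => /(_ isT).
  rewrite subKr => ur'; have : e * r < e * s by rewrite ltr_pM2l.
  by move: vs ur'; rewrite /v; lra.
have {}sT : s < T.
  by rewrite lt_neqAle sT andbT; apply/eqP => sT'; move: vs; rewrite sT' leNgt vT.
have [d d0 dP] := near0_rightP (ur s e s0 e0).
pose h := Num.min d (T - s) / 2.
have h0 : 0 < h by rewrite divr_gt0// lt_min d0 subr_gt0.
have hh : h < Num.min d (T - s) by rewrite /h; move: h0; rewrite /h; lra.
move: hh; rewrite lt_min => /andP[hd hT].
have /(ub_le_sup (proj2 supA)) : A (s + h).
  split; first by apply/andP; split; lra.
  have := dP h; rewrite h0 hd => /(_ isT); move: vs; rewrite /v mulrDr; lra.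
by rewrite -/s gerDl leNgt h0.
Qed.
End RightDerivative.

Section ExponentialPolynomials.
Variables (R : realType).

Lemma is_derive_monomial (m : nat) (t : R) :
  is_derive t 1 (fun t : R => t ^+ m.+1 / m.+1`!%:R) (t ^+ m / m`!%:R).
Proof.
have -> : (fun t : R => t ^+ m.+1 / m.+1`!%:R) = (m.+1`!%:R)^-1 \*: (id ^+ m.+1).
  by apply/funext => s; rewrite /= mulrC /GRing.scale/=; congr (_ * _); rewrite fctE.
apply: is_derive_eq; rewrite /GRing.scale/= mulr1 factS natrM invfM.
by rewrite mulrACA mulVf ?pnatr_eq0// mul1r mulrC.
Qed.

Lemma is_derive_exp_partial (w : nat -> R) (M : nat) (t : R) :
  is_derive t 1 (fun t : R => \sum_(m < M.+1) t ^+ m / m`!%:R * w m)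
    (\sum_(m < M) t ^+ m / m`!%:R * w m.+1).
Proof.
elim: M => [|M IH].
  rewrite big_ord0; under eq_fun do rewrite big_ord1 expr0 fact0 divr1 mul1r.
  exact: is_derive_cst.
rewrite big_ord_recr/=; under eq_fun do rewrite big_ord_recr/=.
apply: is_deriveD.
have -> : (fun t : R => t ^+ M.+1 / M.+1`!%:R * w M.+1) =
    w M.+1 \*: (fun t : R => t ^+ M.+1 / M.+1`!%:R).
  by apply/funext => s /=; rewrite mulrC.
rewrite mulrC; apply: is_deriveZ; exact: is_derive_monomial.
Qed.
End ExponentialPolynomials.

(** * Rates and uniqueness *)

Section Generator.
Variables (R : realType) (S : countType) (moves : S -> seq (R * S)) (c : R).
Hypothesis moves_ge0 : forall x a, a \in moves x -> 0 <= a.1.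
Hypothesis moves_sum : forall x, \sum_(a <- moves x) a.1 = c.

(** The right derivative of [f] at time [0] is [A - c I]. *)
Definition generated_by (f : R -> S -> S -> R) : Prop :=
  forall x y, (f h x y - (x == y)%:R) / h @[h --> 0^'+] -->
    walk moves 1 x y - c * (x == y)%:R.

Lemma transition_super (f : R -> S -> S -> R) (s : seq S) (u t : R) (x y : S) :
  transition_function f -> 0 <= u -> 0 <= t -> uniq s ->
  \sum_(z <- s) f u x z * f t z y <= f (u + t) x y.
Proof.
move=> [f0 _ _ fD] u0 t0 us; rewrite -lee_fin fD//; apply: esum_ge.
exists [set` s]; first by split => //; exact: finite_seq.
by rewrite -fsbig_seq// sumEFin.
Qed.

Lemma transition_le1 (f : R -> S -> S -> R) (t : R) (x y : S) :
  transition_function f -> 0 <= t -> f t x y <= 1.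
Proof.
move=> [f0 f1 _ _] t0; rewrite -lee_fin -(f1 t x)//; apply: esum_ge.
exists [set y]; first by split => //; exact: finite_set1.
by rewrite fsbig_set1.
Qed.

(** Since the rows of [A] sum to [c], the rates out of [x] sum to
    [c - walk moves 1 x x]; the conservativity clause of [has_rates] is thus the
    statement about the diagonal. *)
Lemma has_ratesP (q : S -> S -> R) (f : R -> S -> S -> R) :
  (forall x y, x != y -> q x y = walk moves 1 x y) ->
  (has_rates q f <-> generated_by f).
Proof.
move=> qw; have qx x : (\esum_(y in [set~ x]) (q x y)%:E)%E =
    (c - walk moves 1 x x)%:E.
  have := walk_total moves_ge0 moves_sum 1 x.
  rewrite (esumID [set x])//=; last by move=> y _; rewrite lee_fin walk_ge0.
  rewrite !setTI esum_set1 ?lee_fin ?walk_ge0//.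
  rewrite (eq_esum (b := fun y => (q x y)%:E)); last first.
    by move=> y /= /eqP; rewrite eq_sym => /qw ->.
  by rewrite expr1 => e; rewrite EFinB -e addeAC subee// add0e.
split=> [[fq fd] x y|fg].
  have [<-{y}|xy] := eqVneq x y.
    have := fd x; rewrite qx => /fine_cvg /cvgN; rewrite mulr1 opprB.
    by apply: cvg_right_eq => h _ /=; rewrite -mulNr opprB.
  rewrite mulr0 subr0 -qw//.
  by apply: cvg_right_eq (fq x y xy) => h _; rewrite subr0.
split=> [x y xy|x].
  have := fg x y; rewrite (negbTE xy) mulr0 subr0 -qw//.
  by apply: cvg_right_eq => h _; rewrite subr0.
rewrite qx; apply: cvg_EFin; first exact: nearW.
have := fg x x; rewrite eqxx mulr1 => /cvgN; rewrite opprB.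
by apply: cvg_right_eq => h _ /=; rewrite -mulNr opprB.
Qed.

Lemma generated_scaled (f : R -> S -> S -> R) x y : generated_by f ->
  (expR (c * h) * f h x y - (x == y)%:R) / h @[h --> 0^'+] --> walk moves 1 x y.
Proof.
move=> fg.
have : expR (c * h) * ((f h x y - (x == y)%:R) / h) +
    (x == y)%:R * ((expR (c * h) - 1) / h) @[h --> 0^'+] -->
    1 * (walk moves 1 x y - c * (x == y)%:R) + (x == y)%:R * c.
  apply: cvgD; apply: cvgM.
  - exact: expRM_right1.
  - exact: fg.
  - exact: cvg_cst.
  - exact: expRM_right.
rewrite mul1r [_ * c]mulrC subrK.
by apply: cvg_right_eq => h hp; field; rewrite gt_eqF.
Qed.

(** Since [A^m <= c^m] entrywise, the terms of order at least two of the series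
    are at most those of [exp (c h)], that is [exp (c h) - 1 - c h = o(h)]. *)
Lemma uniformized_generated : generated_by (uniformized moves c).
Proof.
move=> x y; set d := (x == y)%:R; set w := walk moves 1 x y.
have c0 : 0 <= c by rewrite -(moves_sum x) big_seq sumr_ge0// => a /moves_ge0.
pose G h := expR (c * h) * uniformized moves c h x y.
have UG h : uniformized moves c h x y = expR (- c * h) * G h.
  by rewrite mulrA -expRD mulNr addNr expR0 mul1r.
have GE h : 0 <= h -> (G h)%:E =
    (\sum_(m <oo) (h ^+ m / m`!%:R * walk moves m x y)%:E)%E.
  move=> h0; rewrite EFinM (uniformizedE moves_ge0 moves_sum)//.
  by rewrite muleA -EFinM -expRD mulNr addrN expR0 mul1e.
have term0 h m : 0 <= h -> 0 <= h ^+ m / m`!%:R * walk moves m x y.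
  move=> h0; rewrite mulr_ge0 ?walk_ge0// mulr_ge0 ?exprn_ge0 ?invr_ge0 ?ler0n//.
have two h (u : nat -> R) : (\sum_(0 <= m < 2) (h ^+ m / m`!%:R * u m)%:E)%E =
    (u 0 + h * u 1)%:E.
  rewrite sumEFin; congr EFin; rewrite big_nat_recr//= big_nat1.
  by rewrite expr0 expr1 !factS fact0 !divr1 mul1r.
have sandwich (a b : \bar R) (g e u v : R) : (a <= b)%E -> (0 <= a)%E ->
    g%:E = (u%:E + a)%E -> (v%:E + b)%E = e%:E -> u <= g <= u + (e - v).
  move: a b => [a| |] [b| |] //=; rewrite -?EFinD ?lee_fin => ab a0 hg he //.
  by have := EFin_inj hg; have := EFin_inj he; lra.
have bound h : 0 < h -> d + h * w <= G h <= d + h * w + (expR (c * h) - 1 - c * h).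
  move=> /ltW h0; have hw := GE h h0.
  rewrite (nneseries_split 0 2) in hw; last by move=> k _; rewrite lee_fin term0.
  rewrite add0n two in hw.
  have hc := nneseries_expR (mulr_ge0 c0 h0).
  rewrite (nneseries_split 0 2) in hc; last first.
    by move=> k _; rewrite lee_fin mulr_ge0 ?invr_ge0 ?ler0n ?exprn_ge0 ?mulr_ge0.
  have := two (c * h) (fun=> 1); under eq_bigr do rewrite mulr1.
  rewrite add0n in hc => two1; rewrite two1 mulr1 in hc.
  have tails : (\sum_(2 <= m <oo) (h ^+ m / m`!%:R * walk moves m x y)%:E <=
      \sum_(2 <= m <oo) ((c * h) ^+ m / m`!%:R)%:E)%E.
    apply: lee_nneseries => [m _ _|m _]; rewrite lee_fin ?term0//.
    rewrite exprMn -[leRHS]mulrA mulrC ler_wpM2r ?(walk_le moves_ge0)//.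
    by rewrite mulr_ge0 ?exprn_ge0 ?invr_ge0 ?ler0n.
  have tail0 : (0 <= \sum_(2 <= m <oo) (h ^+ m / m`!%:R * walk moves m x y)%:E)%E.
    by apply: nneseries_ge0 => m _ _; rewrite lee_fin term0.
  have := sandwich _ _ _ _ _ _ tails tail0 hw hc; rewrite -/w walk0 -/d.
  by move=> /andP[lo up]; apply/andP; split; lra.
have Gd : (G h - d) / h @[h --> 0^'+] --> w.
  apply: (@squeeze_cvgr _ _ _ _ (fun=> w)
    (fun h => w + ((expR (c * h) - 1) / h - c))).
  - near=> k; have h0 : 0 < k by [].
    have /andP[lo up] := bound k h0; rewrite ler_pdivlMr// ler_pdivrMr//.
    have : (expR (c * k) - 1) / k * k = expR (c * k) - 1 by rewrite divfK ?gt_eqF.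
    by move: (_ / k) => e ek; apply/andP; split; lra.
  - exact: cvg_cst.
  - rewrite -[X in _ --> X]addr0 -[X in _ + X](subrr c).
    apply: cvgD; first exact: cvg_cst.
    by apply: cvgB; [exact: expRM_right|exact: cvg_cst].
have : expR (- c * h) * ((G h - d) / h) + d * ((expR (- c * h) - 1) / h)
    @[h --> 0^'+] --> 1 * w + d * - c.
  apply: cvgD; apply: cvgM => //; first exact: expRM_right1.
  - exact: cvg_cst.
  - exact: expRM_right.
rewrite mul1r mulrN [d * c]mulrC; apply: cvg_right_eq => h hp.
by rewrite UG; field; rewrite gt_eqF.
Unshelve. all: by end_near. Qed.

End Generator.

Section Uniqueness.
Variables (R : realType) (S : countType) (moves : S -> seq (R * S)) (c : R).
Hypothesis moves_ge0 : forall x a, a \in moves x -> 0 <= a.1.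
Hypothesis moves_sum : forall x, \sum_(a <- moves x) a.1 = c.

Lemma sum_walk1 (s : seq S) (g : S -> R) (x : S) : uniq s ->
  {subset [seq a.2 | a <- moves x] <= s} ->
  \sum_(z <- s) walk moves 1 x z * g z = step moves g x.
Proof.
move=> us xs; under eq_bigr do rewrite walk1 mulr_suml.
rewrite exchange_big/= /step big_seq [RHS]big_seq; apply: eq_bigr => a ax.
rewrite (bigD1_seq a.2) ?xs ?map_f//= eqxx mulr1 big1 ?addr0// => z za.
by rewrite eq_sym (negbTE za) mulr0 mul0r.
Qed.

(** One more term of the series is gained by integrating the differential
    inequality for [expR (c * t) * f t x y] in which the previous partial sum is
    inserted. Keeping only finitely many intermediate states in
    Chapman-Kolmogorov yields an inequality, so no limit has to be exchanged
    with an infinite sum. *)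
Lemma generated_ge_partial (f : R -> S -> S -> R) (M : nat) (t : R) (x y : S) :
  transition_function f -> generated_by moves c f -> 0 <= t ->
  \sum_(m < M) t ^+ m / m`!%:R * walk moves m x y <= expR (c * t) * f t x y.
Proof.
move=> ft fg; have [f0 _ f_0 _] := ft.
elim: M t x y => [|M IH] t x y t0.
  by rewrite big_ord0 mulr_ge0 ?expR_ge0 ?f0.
pose p M (z : S) (r : R) := \sum_(m < M) r ^+ m / m`!%:R * walk moves m z y.
pose E (r : R) (z : S) := expR (c * r) * f r z y.
pose G (h : R) (z : S) := expR (c * h) * f h x z.
have E0 r z : 0 <= r -> 0 <= E r z by move=> r0; rewrite mulr_ge0 ?expR_ge0 ?f0.
(* The intermediate states: the targets of the moves, and [x] for the
   diagonal term. *)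
pose s := undup (x :: [seq a.2 | a <- moves x]).
have us : uniq s by exact: undup_uniq.
have xs : x \in s by rewrite mem_undup mem_head.
have sup r h : 0 <= r -> 0 <= h -> \sum_(z <- s) G h z * E r z <= E (r + h) x.
  move=> r0 h0; rewrite /E mulrDr expRD.
  have := transition_super x y ft h0 r0 us; rewrite [h + r]addrC.
  rewrite -(ler_pM2l (expR_gt0 (c * r + c * h))) expRD; apply: le_trans.
  by rewrite mulr_sumr le_eqVlt; apply/orP; left; apply/eqP; apply: eq_bigr => z _;
    rewrite /G; ring.
pose p' r := \sum_(m < M) r ^+ m / m`!%:R * walk moves m.+1 x y.
have dp r : is_derive (r : R) 1 (p M.+1 x : R -> R) (p' r).
  exact: (is_derive_exp_partial (fun m => walk moves m x y)).
rewrite -subr_ge0.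
apply: (@dini_ge0 R (fun t => E t x - p M.+1 x t)) => // [|r e r0 e0|r e r0 e0].
- rewrite /E /p mulr0 expR0 mul1r f_0 big_ord_recl expr0 fact0 divr1 mul1r walk0.
  rewrite big1 ?addr0 ?subrr// => i _.
  by rewrite expr0n /= !mul0r.
(* Left semicontinuity: waiting at [x] during the time [h]. *)
- have rh : r - h @[h --> 0^'+] --> r.
    have : r - h @[h --> 0^'+] --> r - 0.
      apply: cvgB; first exact: cvg_cst.
      by apply: cvg_at_right_filter; exact: cvg_id.
    by rewrite subr0.
  have cp : p M.+1 x (r - h) @[h --> 0^'+] --> p M.+1 x r.
    apply: (@cvg_comp _ _ _ (fun h => r - h) (p M.+1 x) _ (nbhs r)).
      exact: rh.
    apply: differentiable_continuous; apply/derivable1_diffP.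
    by case: (dp r).
  have cG : G h x @[h --> 0^'+] --> (1 : R).
    apply: (@cvg_right_quotient R (fun h => G h x) 1).
    by have := generated_scaled (x := x) (y := x) fg; rewrite eqxx; apply.
  have c0 : 0 <= c by rewrite -(moves_sum x) big_seq sumr_ge0// => a /moves_ge0.
  pose K := expR (c * r); have K0 : 0 < K by exact: expR_gt0.
  have eK : 0 < e / 2 / K by rewrite !divr_gt0.
  have e2 : 0 < e / 2 by rewrite divr_gt0.
  near=> h; have h0 : 0 < h by [].
  have hr : 0 <= r - h by rewrite subr_ge0; near: h; exact: nbhs_right_le.
  have G1 : 1 - e / 2 / K < G h x.
    by near: h; apply: (cvgr_gt _ cG); rewrite gtrDl oppr_lt0.
  have p1 : p M.+1 x r - e / 2 < p M.+1 x (r - h).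
    by near: h; apply: (cvgr_gt _ cp); rewrite gtrDl oppr_lt0.
  have EK : E (r - h) x <= K.
    rewrite -[leRHS]mulr1 ler_pM ?expR_ge0 ?f0 ?(transition_le1 _ _ ft)//.
    by rewrite ler_expR ler_wpM2l// gerDl oppr_le0 ltW.
  have : G h x * E (r - h) x <= E r x.
    have := sup (r - h) h hr (ltW h0); rewrite subrK; apply: le_trans.
    rewrite [leRHS](bigD1_seq x)//= lerDl sumr_ge0// => z _.
    by rewrite !mulr_ge0 ?expR_ge0 ?f0 ?(ltW h0).
  have : (1 - G h x) * E (r - h) x <= e / 2.
    apply: (@le_trans _ _ (e / 2 / K * K)); last by rewrite divfK ?gt_eqF.
    apply: (@le_trans _ _ (e / 2 / K * E (r - h) x)).
      by rewrite ler_wpM2r ?E0// lerBlDr -lerBlDl ltW.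
    by rewrite ler_wpM2l// ltW.
  by lra.
(* [F h] bounds the difference quotient from below, and its limit is
   nonnegative by the induction hypothesis. *)
- pose F h := \sum_(z <- s) ((G h z - (x == z)%:R) / h * E r z)
              - (p M.+1 x (r + h) - p M.+1 x r) / h.
  have cF : F h @[h --> 0^'+] --> step moves (E r) x - p' r.
    apply: cvgB; last exact: is_derive_right.
    rewrite -(sum_walk1 _ us); last first.
      by move=> z zx; rewrite mem_undup in_cons zx orbT.
    apply: cvg_big => [|z _]; first exact: add_continuous.
    apply: cvgM; last exact: cvg_cst.
    exact: generated_scaled.
  have L0 : 0 <= step moves (E r) x - p' r.
    rewrite subr_ge0 /step /p'.
    apply: (@le_trans _ _ (\sum_(a <- moves x) a.1 * p M a.2 r)).
      rewrite le_eqVlt; apply/orP; left; apply/eqP.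
      under [RHS]eq_bigr do rewrite mulr_sumr.
      rewrite exchange_big/=; apply: eq_bigr => m _; rewrite walkS mulr_sumr.
      by apply: eq_bigr => a _; ring.
    rewrite big_seq [leRHS]big_seq; apply: ler_sum => a ax.
    by rewrite ler_wpM2l ?(moves_ge0 ax)// IH.
  near=> h; have h0 : 0 < h by [].
  have Fe : - e < F h.
    near: h; apply: (cvgr_gt _ cF); apply: lt_le_trans L0; by rewrite oppr_lt0.
  have FE : F h * h <= E (r + h) x - E r x - (p M.+1 x (r + h) - p M.+1 x r).
    rewrite mulrBl divfK ?gt_eqF// lerD2r mulr_suml.
    apply: le_trans (lerB (sup r h r0 (ltW h0)) (lexx (E r x))).
    have -> : E r x = \sum_(z <- s) (x == z)%:R * E r z.
      rewrite (bigD1_seq x)//= eqxx mul1r big1 ?addr0// => z.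
      by rewrite eq_sym => /negbTE ->; rewrite mul0r.
    rewrite -sumrB ler_sum// => z _; rewrite -mulrBl mulrAC divfK ?gt_eqF//.
  have : - e * h <= F h * h by rewrite ler_wpM2r ?(ltW h0)// ltW.
  by move: FE; rewrite mulNr; lra.
Unshelve. all: by end_near. Qed.

(** The minorant [uniformized moves c] already has total mass [1]. *)
Lemma generated_unique (f : R -> S -> S -> R) (t : R) (x y : S) :
  transition_function f -> generated_by moves c f -> 0 <= t ->
  f t x y = uniformized moves c t x y.
Proof.
move=> ft fg t0.
have ge z : uniformized moves c t x z <= f t x z.
  rewrite -(ler_pM2l (expR_gt0 (c * t))) -lee_fin EFinM.
  rewrite uniformizedE// muleA -EFinM -expRD mulNr addrN expR0 mul1e.
  apply: lime_le.
    apply: is_cvg_nneseries => m _ _; rewrite lee_fin.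
    by rewrite mulr_ge0 ?walk_ge0// mulr_ge0 ?exprn_ge0 ?invr_ge0 ?ler0n.
  apply: nearW => M; rewrite sumEFin lee_fin big_mkord.
  exact: generated_ge_partial.
have [_ f1 _ _] := ft; have u0 z := uniformized_ge0 moves_ge0 moves_sum x z t0.
have := f1 t x t0.
rewrite (eq_esum (b := fun z => ((f t x z - uniformized moves c t x z)%:E +
    (uniformized moves c t x z)%:E)%E)); last first.
  by move=> z _; rewrite -EFinD subrK.
rewrite esumD; last 2 first.
- by move=> z _; rewrite lee_fin subr_ge0.
- by move=> z _; rewrite lee_fin.
rewrite uniformized_total// => e1.
have e0 : (\esum_(z in [set: S]) (f t x z - uniformized moves c t x z)%:E = 0)%E.
  move: e1; set a := (\esum_(z in _) _)%E.
  by case: a => [a| |] //= e1 //; have := EFin_inj e1; move=> e2; congr EFin; lra.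
apply/eqP; rewrite eq_le ge andbT -subr_le0 -lee_fin -[leRHS]e0.
apply: esum_ge; exists [set y]; first by split => //; exact: finite_set1.
by rewrite fsbig_set1.
Qed.
End Uniqueness.

(** * Free walk and reflection *)

Section FreeWalk.
Variable R : realType.
Implicit Types (a b : R) (m n j : nat) (d : int).

(** The total weight of the paths of [m] steps and displacement [d] on the
    integers, with weight [a] for a step up and [b] for a step down, divided by
    [m!]; [i] is the number of steps down. Dividing by [m!] replaces the
    binomial coefficient by a product, which suits generating functions. *)
Definition free_walk a b m d : R :=
  \sum_(i < m.+1) ((m - i)%N%:Z - i%:Z == d)%:R *
    (a ^+ (m - i) / (m - i)`!%:R * (b ^+ i / i`!%:R)).

Lemma free_walk0 a b d : free_walk a b 0 d = (d == 0)%:R.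
Proof.
by rewrite /free_walk big_ord1 subnn subr0 !expr0 fact0 invr1 !mulr1 eq_sym.
Qed.

Lemma exp_fact_S a k : k.+1%:R * (a ^+ k.+1 / k.+1`!%:R) = a * (a ^+ k / k`!%:R).
Proof.
have k0 : k`!%:R != 0 :> R by rewrite pnatr_eq0 -lt0n fact_gt0.
have k1 : k.+1%:R != 0 :> R by rewrite pnatr_eq0.
rewrite factS natrM exprS; move: k0 k1; move: (k.+1%:R) (k`!%:R) => u v v0 u0.
by field; rewrite v0.
Qed.

Lemma free_walkS a b m d :
  m.+1%:R * free_walk a b m.+1 d =
  a * free_walk a b m (d - 1) + b * free_walk a b m (d + 1).
Proof.
rewrite /free_walk !mulr_sumr.
have split_m (i : 'I_m.+2) : m.+1%:R = (m.+1 - i)%N%:R + i%:R :> R.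
  by rewrite -natrD subnK// -ltnS.
under eq_bigr => i _ do rewrite [X in X * _](split_m i) mulrDl.
rewrite big_split/=; congr (_ + _).
  rewrite big_ord_recr/= subnn mul0r addr0; apply: eq_bigr => i _.
  have im : (i <= m)%N by rewrite -ltnS.
  rewrite subSn// (_ : (_ == d) = ((m - i)%N%:Z - i%:Z == d - 1)); last by lia.
  by rewrite mulrCA [X in _ * X = _]mulrA exp_fact_S; ring.
rewrite big_ord_recl/= mul0r add0r; apply: eq_bigr => i _.
have im : (i <= m)%N by rewrite -ltnS.
rewrite /bump/= add1n subSS mulrCA [X in _ * X = _]mulrCA exp_fact_S.
by rewrite (_ : _ == d = ((m - i)%N%:Z - i%:Z == d + 1)); [ring|lia].
Qed.

Lemma free_walk_ge0 a b m d : 0 <= a -> 0 <= b -> 0 <= free_walk a b m d.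
Proof.
move=> a0 b0; apply: sumr_ge0 => i _; rewrite mulr_ge0 ?ler0n//.
by rewrite !mulr_ge0 ?invr_ge0 ?ler0n ?exprn_ge0.
Qed.

Lemma free_walk_far a b m k : (m < k)%N -> free_walk a b m k%:Z = 0.
Proof.
move=> mk; apply: big1 => i _; rewrite (_ : _ == _ = false) ?mul0r//.
by apply/eqP; lia.
Qed.

(** A path and its mirror image differ by the factor [a / b] for each unit of
    displacement. *)
Lemma free_walk_sym a b m k : 0 < a -> 0 < b ->
  free_walk a b m k%:Z = (a / b) ^+ k * free_walk b a m k%:Z.
Proof.
move=> a0 b0; rewrite /free_walk mulr_sumr; apply: eq_bigr => i _.
case: eqP => [ik|]; last by rewrite !mul0r mulr0.
have -> : (m - i = i + k)%N by lia.
rewrite !mul1r expr_div_n !exprD mulrACA [RHS]mulrCA.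
have bk : b ^+ k != 0 by rewrite expf_neq0// gt_eqF.
have f0 n : n`!%:R != 0 :> R by rewrite pnatr_eq0 -lt0n fact_gt0.
by field; rewrite bk !f0.
Qed.

Lemma free_walk_total a b m (K N : nat) : 0 <= a -> 0 <= b ->
  \sum_(K <= k < N) free_walk a b m k%:Z <= (a + b) ^+ m / m`!%:R.
Proof.
move=> a0 b0; rewrite /free_walk exchange_big/= exprDn mulr_suml.
apply: ler_sum => i _; rewrite -mulr_suml.
have im : (i <= m)%N by rewrite -ltnS.
apply: (@le_trans _ _ (1 * (a ^+ (m - i) / (m - i)`!%:R * (b ^+ i / i`!%:R)))).
  rewrite ler_wpM2r ?mulr_ge0 ?invr_ge0 ?ler0n ?exprn_ge0//.
  rewrite -natr_sum -[leRHS]/(1%:R) ler_nat.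
  case: (_ - _)%R => [x|x]; last by rewrite big1.
  rewrite (eq_bigr (fun k => if pred1 x k then 1 else 0)%N); last first.
    by move=> k _; rewrite /= eqz_nat eq_sym; case: (k == x).
  by rewrite -big_mkcond/= sum1_count count_uniq_mem ?iota_uniq// leq_b1.
rewrite mul1r -mulr_natr le_eqVlt; apply/orP; left; apply/eqP.
have f0 k : k`!%:R != 0 :> R by rewrite pnatr_eq0 -lt0n fact_gt0.
have b0' : 'C(m, i)%:R != 0 :> R by rewrite pnatr_eq0 -lt0n bin_gt0.
by rewrite -(bin_fact im) !natrM; field; rewrite !f0 b0'.
Qed.

(** The predecessor of [0] is [0], so a step down from the empty queue is a
    self-loop; [s] is the weight of additional self-loops. *)
Definition mm1_moves (la mu s : R) (n : nat) : seq (R * nat) :=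
  [:: (la, n.+1); (mu, n.-1); (s, n)].

(** Reflection at the boundary: as functions of [j], the three terms on the
    right satisfy the first-step recursion of the free walk, and the last two
    are images placed so that the values at [j = -1] and [j = 0] agree, by
    [free_walk_sym]. This is what wasting a step down from the empty queue
    requires. The bound on [N] makes the sum contain all its nonzero terms. *)
Lemma walk_reflection la mu m j n N : 0 < la -> 0 < mu ->
  (m + n + j + 2 <= N)%N ->
  walk (mm1_moves la mu 0) m j n / m`!%:R =
  free_walk la mu m (n%:Z - j%:Z)
  + (la / mu) ^+ n * free_walk mu la m (n + j + 1)%:Z
  + (1 - la / mu) * (la / mu) ^+ n *
    \sum_(n + j + 2 <= k < N) free_walk mu la m k%:Z.
Proof.
move=> la0 mu0; elim: m j N => [|m IH] j N mN.
  rewrite walk0 fact0 divr1 !free_walk0.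
  rewrite big1_seq ?mulr0 ?addr0; last first.
    move=> k /=; rewrite mem_index_iota => /andP[kK _].
    by rewrite free_walk0 (_ : _ == _ = false)//; lia.
  rewrite (_ : (n + j + 1)%:Z == 0 = false) ?mulr0 ?addr0; last by lia.
  by congr (nat_of_bool _)%:R; lia.
have m1 : m.+1%:R != 0 :> R by rewrite pnatr_eq0.
apply: (mulfI m1); rewrite factS natrM invfM [LHS]mulrCA mulVKf//.
rewrite walkS /mm1_moves big_cons big_cons big_seq1/= mul0r addr0.
rewrite mulrDl -[la * _ * _]mulrA -[mu * _ * _]mulrA.
rewrite (IH j.+1 N.+1); last by lia.
(* For [j = 0] the formula at [j.-1 = 0] has to be recast as the one at [-1]. *)
have -> : walk (mm1_moves la mu 0) m j.-1 n / m`!%:R =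
  free_walk la mu m (n%:Z - j%:Z + 1) +
  (la / mu) ^+ n * free_walk mu la m (n + j)%:Z +
  (1 - la / mu) * (la / mu) ^+ n *
     \sum_(n + j + 1 <= k < N.-1) free_walk mu la m k%:Z.
  rewrite (IH j.-1 N.-1); last by lia.
  case: j mN => [|j] mN; last first.
    rewrite (_ : (n + j.+1.-1 + 2 = n + j.+1 + 1)%N); last by lia.
    rewrite (_ : (n + j.+1.-1 + 1 = n + j.+1)%N); last by lia.
    by rewrite (_ : n%:Z - j.+1%:Z + 1 = n%:Z - j.+1.-1%:Z)//; lia.
  rewrite /= !addn0 subr0 (_ : n%:Z + 1 = n.+1%:Z); last by lia.
  rewrite !(free_walk_sym m _ la0 mu0) addn1 addn2.
  rewrite [in RHS]big_ltn; last by lia.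
  by rewrite exprS; field; rewrite gt_eqF.
rewrite [in RHS]mulrDr [in RHS]mulrDr free_walkS.
rewrite [_ * (_ * free_walk mu la _ _)]mulrCA free_walkS.
have -> : m.+1%:R * ((1 - la / mu) * (la / mu) ^+ n *
    \sum_(n + j + 2 <= k < N) free_walk mu la m.+1 k%:Z) =
  (1 - la / mu) * (la / mu) ^+ n *
    (mu * \sum_(n + j + 1 <= k < N.-1) free_walk mu la m k%:Z +
     la * \sum_(n + j.+1 + 2 <= k < N.+1) free_walk mu la m k%:Z).
  rewrite mulrCA; congr (_ * _); rewrite mulr_sumr.
  under eq_bigr do rewrite free_walkS.
  rewrite big_split/= -!mulr_sumr; congr (mu * _ + la * _).
    rewrite (_ : (n + j + 2 = (n + j + 1).+1)%N); last by lia.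
    rewrite -[in LHS](ltn_predK mN) big_add1.
    by apply: eq_bigr => k _; congr free_walk; lia.
  rewrite (_ : (n + j.+1 + 2 = (n + j + 2).+1)%N); last by lia.
  by rewrite [RHS]big_add1; apply: eq_bigr => k _; congr free_walk; lia.
rewrite (_ : n%:Z - j.+1%:Z = n%:Z - j%:Z - 1); last by lia.
rewrite (_ : (n + j.+1 + 1)%:Z = (n + j + 1)%:Z + 1); last by lia.
rewrite (_ : (n + j)%:Z = (n + j + 1)%:Z - 1); last by lia.
ring.
Qed.

End FreeWalk.

(** * Bessel functions and the transient queue *)

Section Bessel.
Variable R : realType.
Implicit Types (la mu t : R).

Lemma powR_half (x : R) (k l : nat) : 0 < x ->
  x `^ ((k%:R - l%:R) / 2) = Num.sqrt x ^+ k / Num.sqrt x ^+ l.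
Proof.
move=> x0; rewrite [_ / 2]mulrC powRrM powR12_sqrt ?ltW//.
rewrite powRB; last by apply/implyP => _; rewrite gt_eqF ?sqrtr_gt0.
by rewrite !powR_mulrn ?sqrtr_ge0.
Qed.

(** Summed over the numbers of steps up and down separately, the generating
    function is a double exponential series restricted to a fixed difference
    of the two indices, which is the Bessel series; the prefactor turns the
    powers of [sqrt (la * mu)] into powers of [la] and [mu]. *)
Lemma bessel_free_walk la mu t (d : int) : 0 < la -> 0 < mu -> 0 <= t ->
  (((la / mu) `^ (d%:~R / 2) * besselI d (2 * t * Num.sqrt (la * mu)))%:E =
   \sum_(m <oo) (t ^+ m * free_walk la mu m d)%:E)%E.
Proof.
move=> la0 mu0 t0; set z := 2 * t * _; set r := (la / mu) `^ _.
have z0 : 0 <= z / 2 by rewrite divr_ge0 ?mulr_ge0 ?sqrtr_ge0.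
have r0 : 0 < r by rewrite powR_gt0 ?divr_gt0.
pose u l := (t * la) ^+ l / l`!%:R; pose v k := (t * mu) ^+ k / k`!%:R.
have u0 l : 0 <= u l by rewrite divr_ge0 ?exprn_ge0 ?mulr_ge0 ?ler0n ?(ltW la0).
have v0 l : 0 <= v l by rewrite divr_ge0 ?exprn_ge0 ?mulr_ge0 ?ler0n ?(ltW mu0).
have uv0 l k : 0 <= u l * v k by exact: mulr_ge0.
have buv0 (b : bool) l k : 0 <= b%:R * (u l * v k).
  by rewrite mulr_ge0 ?ler0n ?uv0.
pose x (k : nat) := match k%:Z + d with
    | Posz m => (z / 2) ^+ (k + m) / (k`!%:R * m`!%:R) | Negz _ => 0 end.
have x0 k : 0 <= x k.
  rewrite /x; case: (_ + _)%R => // m.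
  by rewrite divr_ge0 ?exprn_ge0// mulr_ge0 ?ler0n.
have sum_l k : (\sum_(l <oo) ((l%:Z - k%:Z == d)%:R * (u l * v k))%:E =
    (r * x k)%:E)%E.
  rewrite /x; case kd: (k%:Z + d) => [m|m]; last first.
    rewrite mulr0 eseries0// => l _ _.
    by rewrite (_ : _ == d = false) ?mul0r//; apply/eqP; lia.
  rewrite nneseries_esumT; last by move=> l; rewrite lee_fin buv0.
  transitivity (\esum_(l in [set: nat]) ((m == l)%:R * (u l * v k))%:E)%E.
    by apply: eq_esum => l _; rewrite (_ : (_ == d) = (m == l))//; lia.
  rewrite esum_delta ?uv0//; congr EFin.
  have dE : d%:~R = m%:R - k%:R :> R.
    rewrite -[m%:R]/(m%:Z%:~R) -[k%:R]/(k%:Z%:~R) -intrB.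
    by rewrite -kd addrC addKr.
  rewrite /r dE powR_half ?divr_gt0// /u /v /z.
  have -> : 2 * t * Num.sqrt (la * mu) / 2 = t * (Num.sqrt la * Num.sqrt mu).
    by rewrite sqrtrM ?ltW//; field.
  rewrite sqrtrM ?ltW// sqrtrV ?ltW//.
  rewrite -{1}(sqr_sqrtr (ltW la0)) -{1}(sqr_sqrtr (ltW mu0)).
  have : Num.sqrt la != 0 by rewrite gt_eqF ?sqrtr_gt0.
  have : Num.sqrt mu != 0 by rewrite gt_eqF ?sqrtr_gt0.
  move: (Num.sqrt la) (Num.sqrt mu) => a b b0 a0.
  have f0 n : n`!%:R != 0 :> R by rewrite pnatr_eq0 -lt0n fact_gt0.
  rewrite !expr_div_n !exprMn !exprD.
  by field; rewrite !f0 !expf_neq0.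
transitivity (\sum_(k <oo) \sum_(l <oo) ((l%:Z - k%:Z == d)%:R * (u l * v k))%:E)%E;
    last first.
  rewrite -nneseries_antidiagonal; last first.
    by move=> k l; rewrite lee_fin buv0.
  apply: eq_eseriesr => m _; rewrite sumEFin; congr EFin.
  rewrite /free_walk mulr_sumr; apply: eq_bigr => i _.
  have im : (i <= m)%N by rewrite -ltnS.
  rewrite /u /v !exprMn -[in t ^+ m](subnK im) exprD.
  by ring.
have fin : (\sum_(k <oo) (r * x k)%:E < +oo)%E.
  under eq_eseriesr do rewrite -sum_l.
  apply: (@le_lt_trans _ _ (\sum_(k <oo) \sum_(l <oo) (u l * v k)%:E)%E).
    apply: lee_nneseries => [k _ _|k _].
      by apply: nneseries_ge0 => l _ _; rewrite lee_fin buv0.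
    apply: lee_nneseries => [l _ _|l _]; rewrite lee_fin.
      by rewrite buv0.
    by rewrite ler_piMl ?uv0// lern1 leq_b1.
  rewrite (eq_eseriesr (g := fun k => ((expR (t * la))%:E * (v k)%:E)%E)).
    rewrite nneseriesZl; last by move=> k _; rewrite lee_fin.
    by rewrite nneseries_expR ?mulr_ge0 ?(ltW mu0)// -EFinM ltry.
  move=> k _; rewrite -nneseries_expR ?mulr_ge0 ?(ltW la0)// muleC -nneseriesZl.
    by apply: eq_eseriesr => l _; rewrite -EFinM mulrC.
  by move=> l _; rewrite lee_fin u0.
under [RHS]eq_eseriesr do rewrite sum_l.
have rX : (\sum_(k <oo) (r * x k)%:E = r%:E * \sum_(k <oo) (x k)%:E)%E.
  under eq_eseriesr do rewrite EFinM.
  by rewrite nneseriesZl// => k _; rewrite lee_fin.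
have Xfin : (\sum_(k <oo) (x k)%:E)%E \is a fin_num.
  rewrite ge0_fin_numE; last by apply: nneseries_ge0 => k _ _; rewrite lee_fin.
  move: fin; rewrite rX; case: (\sum_(_ <oo) _)%E => [X| |]//.
    by move=> _; exact: ltry.
  by rewrite gt0_muley ?lte_fin.
rewrite rX EFinM; congr (_ * _)%E; rewrite -(fineK Xfin); congr EFin.
by apply: lim_nneseries_fin => [k _|]; [exact: x0|rewrite fineK].
Qed.

End Bessel.

Section TransientMM1.
Variable R : realType.
Implicit Types (la mu t : R).

Lemma mm1_moves_ge0 la mu s (n : nat) a : 0 <= la -> 0 <= mu -> 0 <= s ->
  a \in mm1_moves la mu s n -> 0 <= a.1.
Proof. by move=> la0 mu0 s0; rewrite !inE => /or3P[] /eqP ->. Qed.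

Lemma mm1_moves_sum la mu s (n : nat) :
  \sum_(a <- mm1_moves la mu s n) a.1 = la + mu + s.
Proof. by rewrite !big_cons big_nil addr0 addrA. Qed.

(** The three terms of [phat] are the generating functions of the three terms of
    [walk_reflection]; the factor [1 - la / mu] may be negative, so the three
    series are summed separately as real series. *)
Lemma phat_uniformized la mu t (j n : nat) : 0 < la -> 0 < mu -> 0 <= t ->
  phat la mu t j n = uniformized (mm1_moves la mu 0) (la + mu) t j n.
Proof.
move=> la0 mu0 t0; rewrite /phat /uniformized; congr (_ * _).
set z := 2 * t * _; pose K := (n + j + 2)%N; set rho := la / mu.
have rho0 : 0 < rho by rewrite divr_gt0.
pose B1 := rho `^ ((n%:R - j%:R) / 2) * besselI (n%:Z - j%:Z) z.
pose b k := (mu / la) `^ (k%:R / 2) * besselI k%:Z z.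
pose S m := \sum_(K <= k < m + K) free_walk mu la m k%:Z.
have W0 m d : 0 <= t ^+ m * free_walk la mu m d.
  by rewrite mulr_ge0 ?exprn_ge0// free_walk_ge0 ?ltW.
have V0 m d : 0 <= t ^+ m * free_walk mu la m d.
  by rewrite mulr_ge0 ?exprn_ge0// free_walk_ge0 ?ltW.
have S0 m : 0 <= t ^+ m * S m.
  rewrite mulr_ge0 ?exprn_ge0//; apply: sumr_ge0 => k _.
  by rewrite free_walk_ge0 ?ltW.
have bE k : ((b k)%:E = \sum_(m <oo) (t ^+ m * free_walk mu la m k%:Z)%:E)%E.
  by rewrite -(bessel_free_walk k%:Z mu0 la0 t0) [mu * la]mulrC.
have cvg1 : (fun N => \sum_(0 <= m < N) t ^+ m * free_walk la mu m (n%:Z - j%:Z))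
    @ \oo --> B1.
  apply: cvg_nneseries_fin => [m _|]; first exact: W0.
  by rewrite -bessel_free_walk// intrB.
have cvg2 : (fun N => \sum_(0 <= m < N) t ^+ m * free_walk mu la m (n + j + 1)%:Z)
    @ \oo --> b (n + j + 1)%N.
  by apply: cvg_nneseries_fin => [m _|]; [exact: V0|rewrite bE].
have b0 k : 0 <= b k.
  by rewrite -lee_fin bE; apply: nneseries_ge0 => m _ _; rewrite lee_fin.
have tailE : (\sum_(K <= k <oo) (b k)%:E = \sum_(m <oo) (t ^+ m * S m)%:E)%E.
  rewrite [LHS](eseries_cond _ xpredT)/=; under eq_eseriesr do rewrite bE.
  rewrite nneseries_interchange; last by move=> k m; rewrite lee_fin.
  apply: eq_eseriesr => m _.
  rewrite -(eseries_cond (fun k => (t ^+ m * free_walk mu la m k)%:E) xpredT)/=.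
  rewrite (nneseries_split K m); last by move=> k _; rewrite lee_fin.
  rewrite eseries0 ?adde0; last first.
    by move=> k mk _; rewrite free_walk_far ?mulr0//; rewrite /K in mk; lia.
  by rewrite sumEFin mulr_sumr [(K + m)%N]addnC.
have tail_fin : (\sum_(K <= k <oo) (b k)%:E)%E \is a fin_num.
  rewrite ge0_fin_numE; last by apply: nneseries_ge0 => k _ _; rewrite lee_fin.
  rewrite tailE; apply: (@le_lt_trans _ _ (expR (t * (mu + la)))%:E).
    rewrite -nneseries_expR; last by rewrite mulr_ge0// addr_ge0 ?ltW.
    apply: lee_nneseries => [m _ _|m _]; rewrite lee_fin//.
    by rewrite exprMn -[leRHS]mulrA ler_wpM2l ?exprn_ge0// free_walk_total ?ltW.
  exact: ltry.
set L := \big[+%R/0]_(_ <= k <oo) _.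
have LE : L = fine (\sum_(K <= k <oo) (b k)%:E)%E.
  by apply: lim_nneseries_fin => [k _|]; [exact: b0|rewrite fineK].
have cvg3 : (fun N => \sum_(0 <= m < N) t ^+ m * S m) @ \oo --> L.
  by apply: cvg_nneseries_fin => [m _|]; [exact: S0|rewrite LE fineK].
(* The reflection formula wants the image at [n + j + 1] with the roles of
   [la] and [mu] exchanged. *)
have term2 : rho `^ ((n%:R - j%:R - 1) / 2) =
    rho ^+ n * (mu / la) `^ ((n + j + 1)%:R / 2).
  have : 0 < mu / la by rewrite divr_gt0.
  move=> /(powR_half (n + j + 1) 0); rewrite subr0 expr0 divr1 => ->.
  rewrite -addrA -opprD natr1 powR_half//.
  have -> : mu / la = rho^-1 by rewrite invf_div.
  rewrite sqrtrV ?ltW//.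
  have := sqr_sqrtr (ltW rho0).
  have : Num.sqrt rho != 0 by rewrite gt_eqF ?sqrtr_gt0.
  move: (Num.sqrt rho) => s s0 <-; rewrite expr2 exprMn addn1 -addnS exprD !exprVn.
  by field; rewrite !expf_neq0.
rewrite term2 -[rho ^+ n * _ * _]mulrA -/B1 -/(b (n + j + 1)%N).
apply/esym/cvg_lim => //.
have : (\sum_(0 <= m < N) t ^+ m * free_walk la mu m (n%:Z - j%:Z)
   + rho ^+ n * \sum_(0 <= m < N) t ^+ m * free_walk mu la m (n + j + 1)%:Z
   + (1 - rho) * rho ^+ n * \sum_(0 <= m < N) t ^+ m * S m) @[N --> \oo] -->
   B1 + rho ^+ n * b (n + j + 1)%N + (1 - rho) * rho ^+ n * L.
  apply: cvgD; first apply: cvgD.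
  - exact: cvg1.
  - exact: cvgMl_tmp cvg2.
  - exact: cvgMl_tmp cvg3.
apply: cvg_trans; apply: near_eq_cvg; apply: nearW => N.
rewrite !mulr_sumr -!big_split/=; apply: eq_bigr => m _.
rewrite [RHS]mulrAC -[RHS]mulrA (@walk_reflection R la mu m j n (m + K))//; last first.
  by rewrite /K; lia.
by rewrite -/rho -/(S m); ring.
Qed.

End TransientMM1.

Section LazyMM1.
Variable R : realType.
Implicit Types (la mu s t : R).

Lemma mm1_rate_walk la mu s (m n : nat) : m != n ->
  mm1_rate la mu m n = walk (mm1_moves la mu s) 1 m n.
Proof.
move=> mn; rewrite walk1 /mm1_moves !big_cons big_nil/= (negbTE mn) mulr0 !addr0.
rewrite /mm1_rate [n == _]eq_sym; case: eqP => [<-|_].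
  by rewrite (_ : _ == _ = false) ?mulr1 ?mulr0 ?addr0//; lia.
rewrite mulr0 add0r; case: eqP => [->|mn1]; first by rewrite eqxx mulr1.
by rewrite (_ : _ == _ = false) ?mulr0//; lia.
Qed.

Lemma has_rates_uniformized (S : countType) (moves : S -> seq (R * S)) (c : R)
    (q : S -> S -> R) :
  (forall x a, a \in moves x -> 0 <= a.1) ->
  (forall x, \sum_(a <- moves x) a.1 = c) ->
  (forall x y, x != y -> q x y = walk moves 1 x y) ->
  has_rates q (uniformized moves c).
Proof.
move=> m0 mc qw; apply/(has_ratesP m0 mc _ qw).
exact: uniformized_generated.
Qed.

Lemma has_rates_unique (S : countType) (moves : S -> seq (R * S)) (c : R)
    (q : S -> S -> R) (f : R -> S -> S -> R) (t : R) (x y : S) :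
  (forall x a, a \in moves x -> 0 <= a.1) ->
  (forall x, \sum_(a <- moves x) a.1 = c) ->
  (forall x y, x != y -> q x y = walk moves 1 x y) ->
  transition_function f -> has_rates q f -> 0 <= t ->
  f t x y = uniformized moves c t x y.
Proof.
move=> m0 mc qw ft fq t0; apply: generated_unique => //.
by apply/(has_ratesP m0 mc _ qw).
Qed.

(** Adding self-loops of weight [s] amounts to uniformizing at the higher rate
    [la + mu + s]; both walks have the rates of the queue. *)
Lemma phat_lazy la mu s t (j n : nat) : 0 < la -> 0 < mu -> 0 <= s -> 0 <= t ->
  phat la mu t j n = uniformized (mm1_moves la mu s) (la + mu + s) t j n.
Proof.
move=> la0 mu0 s0 t0; rewrite phat_uniformized//.
have ge0 r : 0 <= r -> forall x a, a \in mm1_moves la mu r x -> 0 <= a.1.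
  by move=> r0 x a; apply: mm1_moves_ge0 => //; exact: ltW.
have su0 := mm1_moves_sum la mu 0; rewrite addr0 in su0.
apply: (has_rates_unique (q := mm1_rate la mu)) => //.
- exact: ge0.
- exact: mm1_moves_sum.
- by move=> x y; exact: mm1_rate_walk.
- by apply: uniformized_transition => //; exact: ge0.
- apply: has_rates_uniformized => //; first exact: ge0.
  by move=> x y; exact: mm1_rate_walk.
Qed.

Lemma phat_transition la mu : 0 < la -> 0 < mu ->
  transition_function (phat la mu) /\ has_rates (mm1_rate la mu) (phat la mu).
Proof.
move=> la0 mu0; pose U := uniformized (mm1_moves la mu 0) (la + mu).
have UE t j n : 0 <= t -> phat la mu t j n = U t j n by exact: phat_uniformized.
have ge0 x a : a \in mm1_moves la mu 0 x -> 0 <= a.1.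
  by apply: mm1_moves_ge0 => //; exact: ltW.
have su0 := mm1_moves_sum la mu 0; rewrite addr0 in su0.
have [U0 U1 U_0 UD] : transition_function U by exact: uniformized_transition.
have [Uq Ud] : has_rates (mm1_rate la mu) U.
  by apply: has_rates_uniformized => // x y; exact: mm1_rate_walk.
split; split.
- by move=> t x y t0; rewrite UE// U0.
- by move=> t x t0; under eq_esum do rewrite UE//; exact: U1.
- by move=> x y; rewrite UE.
- move=> s t x y s0 t0; rewrite UE ?addr_ge0// UD//.
  by apply: eq_esum => z _; rewrite !UE.
- by move=> x y xy; apply: cvg_right_eq (Uq x y xy) => h /ltW h0; rewrite UE.
- move=> x; have := Ud x; apply: cvg_trans; apply: near_eq_cvg; near=> h.
  by rewrite UE.
Unshelve. all: by end_near. Qed.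

End LazyMM1.

(** * The Beta integral *)

Section BetaIntegral.
Variable R : realType.
Implicit Types (t x : R) (i l : nat).

(** A primitive of the integrand of [beta_monomial], obtained by integrating
    by parts until the power of [t - x] is used up. *)
Fixpoint beta_primitive t l i x : R :=
  if l is l'.+1 then
    x ^+ i.+1 / i.+1`!%:R * ((t - x) ^+ l / l`!%:R) + beta_primitive t l' i.+1 x
  else x ^+ i.+1 / i.+1`!%:R.

Lemma is_derive_beta_primitive t l i x :
  is_derive x 1 (beta_primitive t l i) (x ^+ i / i`!%:R * ((t - x) ^+ l / l`!%:R)).
Proof.
elim: l i => [|l IH] i /=.
  by rewrite expr0 fact0 divr1 mulr1; exact: is_derive_monomial.
have dt : is_derive x 1 (fun x => (t - x) ^+ l.+1 / l.+1`!%:R)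
    (- ((t - x) ^+ l / l`!%:R)).
  have -> : (fun x => (t - x) ^+ l.+1 / l.+1`!%:R) =
      (l.+1`!%:R)^-1 \*: ((cst t - id) ^+ l.+1).
    by apply/funext => y; rewrite /= mulrC /GRing.scale/=; congr (_ * _); rewrite fctE.
  apply: is_derive_eq; rewrite /GRing.scale/= sub0r mulrN1 factS natrM invfM mulrN.
  by rewrite mulrACA mulVf ?pnatr_eq0// mul1r mulrC.
have := is_deriveD (is_deriveM (is_derive_monomial i x) dt) (IH i.+1).
by rewrite /GRing.scale/= mulrN addrAC addNr add0r [_ * (x ^+ i / _)]mulrC; apply.
Qed.

Lemma beta_primitive0 t l i : beta_primitive t l i 0 = 0.
Proof. by elim: l i => [|l IH] i /=; rewrite ?IH expr0n !mul0r ?addr0. Qed.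

Lemma beta_primitive_end t l i :
  beta_primitive t l i t = t ^+ (i + l).+1 / (i + l).+1`!%:R.
Proof.
elim: l i => [|l IH] i /=; first by rewrite addn0.
by rewrite IH subrr expr0n/= mul0r mulr0 add0r addSnnS.
Qed.

Lemma continuous_beta_monomial t i l :
  continuous (fun x => x ^+ i / i`!%:R * ((t - x) ^+ l / l`!%:R)).
Proof.
have -> : (fun x => x ^+ i / i`!%:R * ((t - x) ^+ l / l`!%:R)) =
    horner ((i`!%:R^-1)%:P * 'X^i * ((l`!%:R^-1)%:P * (t%:P - 'X) ^+ l)).
  by apply/funext => x; rewrite !hornerE/=; ring.
exact: continuous_horner.
Qed.

Lemma beta_monomial t i l : 0 <= t ->
  (\int[lebesgue_measure]_(x in `[0%R, t])
     (x ^+ i / i`!%:R * ((t - x) ^+ l / l`!%:R))%:E =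
   (t ^+ (i + l).+1 / (i + l).+1`!%:R)%:E)%E.
Proof.
rewrite le_eqVlt => /predU1P[<-|t0].
  by rewrite set_itv1 integral_set1 expr0n/= mul0r.
have dF x : derivable (beta_primitive t l i) x 1.
  by case: (is_derive_beta_primitive t l i x).
have cF x : {for x, continuous (beta_primitive t l i)}.
  by apply: differentiable_continuous; apply/derivable1_diffP.
rewrite (@continuous_FTC2 R _ (beta_primitive t l i))//.
- by rewrite beta_primitive0 beta_primitive_end sube0.
- by apply: continuous_subspaceT => x; exact: continuous_beta_monomial.
- split=> [x _//||]; first by apply: cvg_at_right_filter; exact: cF.
  by apply: cvg_at_left_filter; exact: cF.
- move=> x _; rewrite derive1E.
  by case: (is_derive_beta_primitive t l i x).
Qed.
(** Monotone convergence, twice, reduces the integral to [beta_monomial]. *)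
Lemma integral_beta_series t (E : R) (w : nat -> nat -> R) : 0 <= t -> 0 <= E ->
  (forall i l, 0 <= w i l) ->
  (\int[lebesgue_measure]_(x in `[0%R, t]) (E%:E * \sum_(i <oo) \sum_(l <oo)
     (w i l * (x ^+ i / i`!%:R * ((t - x) ^+ l / l`!%:R)))%:E) =
   E%:E * \sum_(i <oo) \sum_(l <oo)
     (w i l * (t ^+ (i + l).+1 / (i + l).+1`!%:R))%:E)%E.
Proof.
move=> t0 E0 w0; pose g i l x := x ^+ i / i`!%:R * ((t - x) ^+ l / l`!%:R).
pose h i l x := (w i l * g i l x)%:E.
have g0 i l x : `[0%R, t]%classic x -> 0 <= g i l x.
  rewrite /= in_itv/= => /andP[x0 xt].
  by rewrite mulr_ge0// divr_ge0 ?exprn_ge0 ?ler0n ?subr_ge0.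
have h0 i l x : `[0%R, t]%classic x -> (0 <= h i l x)%E.
  by move=> Dx; rewrite lee_fin mulr_ge0 ?g0.
have mg i l : measurable_fun `[0%R, t]%classic (g i l).
  apply: measurable_funTS; apply: continuous_measurable_fun.
  exact: continuous_beta_monomial.
have mh i l : measurable_fun `[0%R, t]%classic (h i l).
  by apply/measurable_EFinP; apply: measurable_funM.
have mS i : measurable_fun `[0%R, t]%classic (fun x => (\sum_(l <oo) h i l x)%E).
  by apply: ge0_emeasurable_sum => [l x Dx _|l _]; [exact: h0|exact: mh].
have S0 i x : `[0%R, t]%classic x -> (0 <= \sum_(l <oo) h i l x)%E.
  by move=> Dx; apply: nneseries_ge0 => l _ _; exact: h0.
rewrite ge0_integralZl_EFin//; last 2 first.
- by move=> x Dx; apply: nneseries_ge0 => i _ _; exact: S0.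
- by apply: ge0_emeasurable_sum => [i x Dx _|i _]; [exact: S0|exact: mS].
congr (_ * _)%E; rewrite integral_nneseries//.
apply: eq_eseriesr => i _; rewrite integral_nneseries//; last 2 first.
- exact: (mh i).
- exact: (h0 i).
apply: eq_eseriesr => l _; rewrite /h EFinM -beta_monomial//.
rewrite -ge0_integralZl_EFin//.
- by move=> x Dx; rewrite lee_fin g0.
- by apply/measurable_EFinP; exact: mg.
Qed.
End BetaIntegral.

(** * The queue in two environments *)

Section Queue.
Variables (R : realType) (lambda mu eta : env -> R).
Hypotheses (lambda_gt0 : forall e, 0 < lambda e) (mu_gt0 : forall e, 0 < mu e).
Hypotheses (eta1_gt0 : 0 < eta env1) (eta2_eq0 : eta env2 = 0).

(** The total rate of the other environment is spent on self-loops, so that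
    both environments are uniformized at the same rate. *)
Definition slack (e : env) : R := lambda (~~ e) + mu (~~ e) + eta (~~ e).

Definition queue_moves (x : nat * env) : seq (R * (nat * env)) :=
  [:: (lambda x.2, (x.1.+1, x.2)); (mu x.2, (x.1.-1, x.2));
      (eta x.2, (x.1, ~~ x.2)); (slack x.2, x)].

Definition queue_total : R := lambda env1 + mu env1 + eta env1 + slack env1.

Let eta_ge0 e : 0 <= eta e.
Proof. by case: e; rewrite ?eta2_eq0// ltW. Qed.

Let slack_ge0 e : 0 <= slack e.
Proof. by rewrite /slack !addr_ge0// ltW. Qed.

Lemma queue_moves_ge0 x a : a \in queue_moves x -> 0 <= a.1.
Proof. by rewrite !inE => /or4P[] /eqP -> //=; rewrite ltW. Qed.

Lemma queue_moves_sum x : \sum_(a <- queue_moves x) a.1 = queue_total.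
Proof.
rewrite !big_cons big_nil/= /queue_total /slack.
by case: x.2 => /=; ring.
Qed.

Lemma queue_rate_walk x y : x != y ->
  queue_rate lambda mu eta x y = walk queue_moves 1 x y.
Proof.
move: x y => [m e] [n e'] xy; rewrite walk1 !big_cons big_nil/= (negbTE xy).
rewrite mulr0 !addr0 !xpair_eqE /queue_rate/=.
have [ee'|ee'] := eqVneq e e'; last first.
  by rewrite !andbF !mulr0 !add0r; case: (m == n);
    move: ee'; case: e e' {xy} => -[]//= _; rewrite ?mulr1 ?mulr0.
have mn : m != n by move: xy; rewrite ee' xpair_eqE eqxx andbT.
rewrite (mm1_rate_walk _ _ 0 mn) walk1 !big_cons big_nil/= !andbT mul0r !addr0.
by rewrite (negbTE mn) mulr0 addr0.
Qed.

Local Notation env_moves e := (mm1_moves (lambda e) (mu e) (slack e)).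

Lemma env_moves_ge0 e n a : a \in env_moves e n -> 0 <= a.1.
Proof. by apply: mm1_moves_ge0 => //; exact: ltW. Qed.

Lemma walk_env2 m j n :
  walk queue_moves m (j, env2) (n, env2) = walk (env_moves env2) m j n /\
  walk queue_moves m (j, env2) (n, env1) = 0.
Proof.
elim: m j => [|m IH] j; first by rewrite !walk0 !xpair_eqE andbT andbF.
rewrite !walkS !big_cons !big_nil/= eta2_eq0 !mul0r !add0r !addr0.
by rewrite !(proj1 (IH _)) !(proj2 (IH _)) !mulr0 !addr0.
Qed.

Lemma walk_env1 m j n :
  walk queue_moves m (j, env1) (n, env1) = walk (env_moves env1) m j n.
Proof.
elim: m j => [|m IH] j; first by rewrite !walk0 !xpair_eqE andbT.
rewrite !walkS !big_cons !big_nil/= !IH (proj2 (walk_env2 _ _ _)).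
by rewrite mulr0 add0r.
Qed.

(** The weight of the paths that make [i] steps in environment 1, switch, and
    make [l] steps in environment 2, without the weight of the switch. *)
Definition switch_walk (i l j n : nat) : R :=
  iter i (step (env_moves env1)) (fun k => walk (env_moves env2) l k n) j.

Lemma switch_walk_ge0 i l j n : 0 <= switch_walk i l j n.
Proof.
by apply: iter_step_ge0 => [x a|z]; [|apply: walk_ge0 => x a]; exact: env_moves_ge0.
Qed.

(** Block triangularity: the paths are sorted by the time of their only
    switch. *)
Lemma walk_env12 m j n :
  walk queue_moves m.+1 (j, env1) (n, env2) =
  eta env1 * \sum_(i < m.+1) switch_walk i (m - i) j n.
Proof.
suff H k i : walk queue_moves k (i, env1) (n, env2) =
    eta env1 * \sum_(i' < k) switch_walk i' (k.-1 - i') i n by rewrite H.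
elim: k i => [|k IH] i.
  by rewrite walk0 xpair_eqE andbF big_ord0 mulr0.
rewrite walkS !big_cons big_nil/= !IH (proj1 (walk_env2 _ _ _)) big_ord_recl subn0.
have -> : \sum_(i' < k) switch_walk (lift ord0 i') (k - lift ord0 i') i n =
    \sum_(i' < k) step (env_moves env1) (switch_walk i' (k.-1 - i') ^~ n) i.
  apply: eq_bigr => i' _; rewrite lift0.
  by rewrite (_ : (k - i'.+1 = k.-1 - i')%N); [|lia].
rewrite /step exchange_big/= !big_cons big_nil/=.
rewrite -!mulr_sumr /switch_walk/=; ring.
Qed.

Lemma switch_walk_esum i l j n :
  ((switch_walk i l j n)%:E = \sum_(k <oo)
    (walk (env_moves env1) i j k * walk (env_moves env2) l k n)%:E)%E.
Proof.
have m1 x a := @env_moves_ge0 env1 x a; have m2 x a := @env_moves_ge0 env2 x a.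
rewrite nneseries_esumT; last by move=> k; rewrite lee_fin mulr_ge0 ?walk_ge0.
by rewrite esum_walk// => z; exact: walk_ge0.
Qed.

Local Notation Q := (uniformized queue_moves queue_total).
Local Notation ph e := (phat (lambda e) (mu e)).

Lemma queue_env2 t j n : 0 <= t -> Q t (j, env2) (n, env2) = ph env2 t j n.
Proof.
move=> t0.
rewrite (phat_lazy j n (lambda_gt0 env2) (mu_gt0 env2) (slack_ge0 env2) t0).
have -> : lambda env2 + mu env2 + slack env2 = queue_total.
  by rewrite /queue_total /slack/= eta2_eq0; ring.
rewrite /uniformized; congr (_ * _).
apply: eq_lim_series => m.
by rewrite (proj1 (walk_env2 _ _ _)).
Qed.

Lemma queue_env21 t j n : 0 <= t -> Q t (j, env2) (n, env1) = 0.
Proof.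
move=> t0; rewrite /uniformized (_ : limn _ = 0) ?mulr0//.
apply/cvg_lim => //; rewrite (_ : (fun _ => _) = cst 0); first exact: cvg_cst.
by apply/funext => N; rewrite big1// => m _; rewrite (proj2 (walk_env2 _ _ _)) mulr0.
Qed.

(** The moves inside environment 1 have total weight smaller by [eta env1] than
    the uniformization rate; the deficit is the killing rate. *)
Lemma queue_env1 t j n : 0 <= t ->
  Q t (j, env1) (n, env1) = expR (- eta env1 * t) * ph env1 t j n.
Proof.
move=> t0.
rewrite (phat_lazy j n (lambda_gt0 env1) (mu_gt0 env1) (slack_ge0 env1) t0).
rewrite /uniformized mulrA -expRD; congr (expR _ * _).
  by rewrite /queue_total; ring.
apply: eq_lim_series => m.
by rewrite walk_env1.
Qed.

(** Both sides expand into the double series over the numbers of steps before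
    and after the switch; on the right-hand side the exponential factors
    combine to the constant [E], and integration over the time of the switch
    is the Beta integral. *)
Lemma queue_env12 t j n : 0 <= t ->
  ((Q t (j, env1) (n, env2))%:E = (eta env1)%:E *
    \sum_(k <oo) \int[lebesgue_measure]_(tau in `[0%R, t])
      (expR (- eta env1 * tau) * ph env1 tau j k * ph env2 (t - tau) k n)%:E)%E.
Proof.
move=> t0; rewrite uniformizedE//; last 2 first.
- exact: queue_moves_ge0.
- exact: queue_moves_sum.
set E := expR _; have E0 : 0 <= E by exact: expR_ge0.
pose w i l k := walk (env_moves env1) i j k * walk (env_moves env2) l k n.
have m1 x a := @env_moves_ge0 env1 x a; have m2 x a := @env_moves_ge0 env2 x a.
have w0 i l k : 0 <= w i l k by rewrite mulr_ge0 ?walk_ge0.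
pose c i l := t ^+ (i + l).+1 / (i + l).+1`!%:R.
have c0 i l : 0 <= c i l by rewrite divr_ge0 ?exprn_ge0 ?ler0n.
have integralE k : (\int[lebesgue_measure]_(tau in `[0%R, t])
      (expR (- eta env1 * tau) * ph env1 tau j k * ph env2 (t - tau) k n)%:E =
    E%:E * \sum_(i <oo) \sum_(l <oo) (w i l k * c i l)%:E)%E.
  rewrite -integral_beta_series//; apply: eq_integral => x.
  rewrite inE/= in_itv/= => /andP[x0 xt].
  have tx0 : 0 <= t - x by rewrite subr_ge0.
  rewrite (phat_lazy _ _ (lambda_gt0 env1) (mu_gt0 env1) (slack_ge0 env1) x0).
  rewrite (phat_lazy _ _ (lambda_gt0 env2) (mu_gt0 env2) (slack_ge0 env2) tx0).
  have s1 n' := mm1_moves_sum (lambda env1) (mu env1) (slack env1) n'.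
  have s2 n' := mm1_moves_sum (lambda env2) (mu env2) (slack env2) n'.
  rewrite EFinM EFinM (uniformizedE m1 s1)// (uniformizedE m2 s2)//.
  rewrite [X in (X * _)%E]muleA muleACA -!EFinM nneseries_mul; last 4 first.
  - by move=> i; exact: walk_term_ge0.
  - by move=> l; exact: walk_term_ge0.
  - by rewrite (walk_series_fin m1 s1).
  - by rewrite (walk_series_fin m2 s2).
  congr (_ * _)%E.
    rewrite -!expRD /E; congr (expR _)%:E.
    by rewrite /queue_total /slack/= eta2_eq0; ring.
  apply: eq_eseriesr => i _; apply: eq_eseriesr => l _; congr EFin.
  by rewrite /w; ring.
have cw0 i l k : 0 <= w i l k * c i l by rewrite mulr_ge0.
have tripleE : (\sum_(k <oo) \sum_(i <oo) \sum_(l <oo) (w i l k * c i l)%:E =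
    \sum_(i <oo) \sum_(l <oo) (c i l * switch_walk i l j n)%:E)%E.
  rewrite nneseries_interchange; last first.
    by move=> k i; apply: nneseries_ge0 => ? _ _; rewrite lee_fin.
  apply: eq_eseriesr => i _; rewrite nneseries_interchange; last first.
    by move=> k l; rewrite lee_fin.
  apply: eq_eseriesr => l _; rewrite EFinM switch_walk_esum -nneseriesZl; last first.
    by move=> k _; rewrite lee_fin w0.
  by apply: eq_eseriesr => k _; rewrite -EFinM mulrC.
transitivity ((eta env1)%:E * (E%:E * \sum_(i <oo) \sum_(l <oo)
    (c i l * switch_walk i l j n)%:E))%E; last first.
  congr (_ * _)%E; rewrite -tripleE -nneseriesZl; last first.
    by move=> k _; do 2!(apply: nneseries_ge0 => ? _ _); rewrite lee_fin.
  by apply: eq_eseriesr => k _; rewrite integralE.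
rewrite muleCA; congr (_ * _)%E.
rewrite nneseries_recl//; last first.
  by move=> m; rewrite lee_fin walk_term_ge0//; exact: queue_moves_ge0.
rewrite walk0 xpair_eqE andbF mulr0 add0e -nneseries_antidiagonal; last first.
  by move=> i l; rewrite lee_fin mulr_ge0// switch_walk_ge0.
rewrite -(nneseries_addn 1)/=; last first.
  by move=> m; rewrite lee_fin walk_term_ge0//; exact: queue_moves_ge0.
rewrite -nneseriesZl; last first.
  by move=> m _; apply: sume_ge0 => i _; rewrite lee_fin mulr_ge0// switch_walk_ge0.
apply: eq_eseriesr => m _; rewrite addn1 walk_env12 sumEFin -EFinM; congr EFin.
rewrite mulrCA; congr (_ * _); rewrite mulr_sumr; apply: eq_bigr => i _.
by rewrite /c subnKC// -ltnS.
Qed.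

End Queue.

(** * The law of the process *)

Section InitialLaw.
Local Open Scope ereal_scope.

(** The event outside [A1] and [A2] is negligible because their probabilities
    add up to [1]. *)
Lemma probability_two_atoms (R : realType) (d : measure_display)
    (Omega : measurableType d) (P : probability Omega R) (A1 A2 B : set Omega)
    (p : R) :
  measurable A1 -> measurable A2 -> measurable B -> A1 `&` A2 = set0 ->
  P A1 = p%:E -> P A2 = (1 - p)%:E ->
  P B = P (A1 `&` B) + P (A2 `&` B).
Proof.
move=> m1 m2 mB A12 P1 P2.
have PU : P (~` (A1 `|` A2)) = 0.
  rewrite probability_setC; last exact: measurableU.
  have -> : P (A1 `|` A2) = P A1 + P A2 by exact: measureU.
  by rewrite P1 P2 -EFinD addrCA subrr addr0 subrr.
have -> : P B = P (B `\` A1) + P (B `&` A1) by exact: measureDI.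
rewrite addeC [B `&` A1]setIC; congr (_ + _).
have -> : P (B `\` A1) = P ((B `\` A1) `\` A2) + P ((B `\` A1) `&` A2).
  by apply: measureDI => //; exact: measurableD.
rewrite [X in X + _ = _](_ : _ = 0) ?add0e.
  congr (P _); rewrite setIC setIDA; apply/seteqP; split=> w [].
    by [].
  by move=> A2w Bw; split => // A1w; have : set0 w by rewrite -A12.
apply: subset_measure0 PU => //.
- by apply: measurableD => //; exact: measurableD.
- by apply: measurableC; exact: measurableU.
- by move=> w [[Bw A1w] A2w] [].
Qed.

Lemma markov_law (R : realType) (d : measure_display)
    (Omega : measurableType d) (P : probability Omega R) (S : countType)
    (f : R -> S -> S -> R) (X : R -> Omega -> S) (x1 x2 : S) (p t : R) (y : S) :
  markov_process P f X -> x1 != x2 -> (0 <= t)%R ->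
  P [set w | X 0%R w = x1] = p%:E -> P [set w | X 0%R w = x2] = (1 - p)%:E ->
  P [set w | X t w = y] = (p * f t x1 y + (1 - p) * f t x2 y)%:E.
Proof.
move=> [mX markov] x12 t0 P1 P2.
have joint x : P ([set w | X 0%R w = x] `&` [set w | X t w = y]) =
    P [set w | X 0%R w = x] * (f t x y)%:E.
  have /(_ t0) /= := markov [::] 0%R t x y (fun u => ltac:(by [])) (lexx _).
  rewrite (_ : [set w | _] = setT); last by apply/seteqP; split.
  by rewrite !setTI add0r.
rewrite (probability_two_atoms (mX 0%R x1 (lexx _)) (mX 0%R x2 (lexx _)) (mX t y t0)
  _ P1 P2) ?joint ?P1 ?P2//.
by apply/seteqP; split=> w //= [-> /eqP]; rewrite (negbTE x12).
Qed.
End InitialLaw.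

Theorem proposition2 (R : realType) (d : measure_display)
    (Omega : measurableType d) (P : probability Omega R)
    (lambda mu eta : env -> R) (p : R) (N : R -> Omega -> nat * env)
    (j : nat)
    (hlambda : forall i, 0 < lambda i) (hmu : forall i, 0 < mu i)
    (heta1 : 0 < eta env1) (heta2 : eta env2 = 0)
    (hp : 0 <= p <= 1)
    (hN : ctmc P (queue_rate lambda mu eta) N)
    (hinit1 : P [set w | N 0 w = (j, env1)] = p%:E)
    (hinit2 : P [set w | N 0 w = (j, env2)] = (1 - p)%:E) :
  (forall i, transition_function (phat (lambda i) (mu i)) /\
             has_rates (mm1_rate (lambda i) (mu i))
                       (phat (lambda i) (mu i))) /\
  (forall (t : R) (n : nat), 0 <= t ->
     P [set w | N t w = (n, env1)] =
       (p * expR (- eta env1 * t) *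
        phat (lambda env1) (mu env1) t j n)%:E /\
     P [set w | N t w = (n, env2)] =
       (((1 - p) * phat (lambda env2) (mu env2) t j n)%:E +
        (p * eta env1)%:E *
        \sum_(0 <= k <oo)
          \int[lebesgue_measure]_(tau in `[0%R, t])
            (expR (- eta env1 * tau) *
             phat (lambda env1) (mu env1) tau j k *
             phat (lambda env2) (mu env2) (t - tau) k n)%:E)%E).
Proof.
split=> [i|t n t0]; first exact: phat_transition.
have [f [ft fq fN]] := hN.
have fE x y : f t x y =
    uniformized (queue_moves lambda mu eta) (queue_total lambda mu eta) t x y.
  apply: has_rates_unique ft fq t0.
  - by move=> z a; exact: queue_moves_ge0.
  - exact: queue_moves_sum.
  - by move=> z z'; exact: queue_rate_walk.
have x12 : (j, env1) != (j, env2) by rewrite xpair_eqE andbF.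
split; rewrite (markov_law _ fN x12 t0 hinit1 hinit2) !fE.
  by rewrite queue_env1// queue_env21// mulr0 addr0 mulrA.
rewrite queue_env2// addrC EFinD; congr (_ + _)%E.
by rewrite EFinM queue_env12// muleA -EFinM.
Qed.
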